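(* Let $r$, $P$ and $W$ be Lipschitz continuous (with constants $L_r,L_P,L_W>0$). Then there exists an $L^p$ graphon mean field equilibrium (GMFE) $(\boldsymbol\pi,\boldsymbol\mu)\in\boldsymbol\Pi\times\boldsymbol{\mathcal M}$, i.e. a pair with $\boldsymbol\mu=\Psi(\boldsymbol\pi)$ and $\pi^\alpha\in\arg\max_{\pi\in\Pi}J^{\boldsymbol\mu}_\alpha(\pi)$ for every $\alpha\in[0,1]$.
   Context: Let $\mathcal X,\mathcal U$ be finite sets (states, actions), $T\in\mathbb N$, $\mathcal T=\{0,\dots,T-1\}$, $\mathcal I=[0,1]$. For a finite set $A$, $\mathcal P(A)$ is the set of probability measures and $\mathcal B(A)$ the set of bounded nonnegative measures on $A$, identified with vectors in $\mathbb R^{|A|}$ with the $\ell_1$ norm. Fix a transition kernel $P:\mathcal X\times\mathcal U\times\mathcal B(\mathcal X)\to\mathcal P(\mathcal X)$, a reward $r:\mathcal X\times\mathcal U\times\mathcal B(\mathcal X)\to\mathbb R$, an initial law $\mu_0\in\mathcal P(\mathcal X)$, and a graphon $W:[0,1]^2\to[0,\infty)$ (symmetric, measurable, integrable). Policies: $\Pi=\mathcal P(\mathcal U)^{\mathcal T\times\mathcal X}$, written $\pi_t(u\mid x)$. Policy ensembles $\boldsymbol\Pi$: families $(\pi^\alpha)_{\alpha\in\mathcal I}$ with $\alpha\mapsto\pi^\alpha_t(u\mid x)$ measurable for all $t,u,x$. Mean field ensembles $\boldsymbol{\mathcal M}$: families $(\mu^\alpha_t)_{\alpha\in\mathcal I,t}$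 of elements of $\mathcal P(\mathcal X)$ with $\alpha\mapsto\mu^\alpha_t(x)$ measurable; $\boldsymbol\mu_t=(\mu^\alpha_t)_\alpha$. Neighborhood mean field: $\mathbb G^\alpha(\boldsymbol\mu_t)=\int_{\mathcal I}W(\alpha,\beta)\mu^\beta_t\,d\beta\in\mathcal B(\mathcal X)$. $\Psi(\boldsymbol\pi)=\boldsymbol\mu$ is defined recursively by $\mu^\alpha_0=\mu_0$, $\mu^\alpha_{t+1}(x)=\sum_{x'}\mu^\alpha_t(x')\sum_u\pi^\alpha_t(u\mid x')P(x\mid x',u,\mathbb G^\alpha(\boldsymbol\mu_t))$. For $\boldsymbol\mu\in\boldsymbol{\mathcal M}$, $\alpha\in\mathcal I$, $\pi\in\Pi$: $J^{\boldsymbol\mu}_\alpha(\pi)=\mathbb E[\sum_{t=0}^{T-1}r(X_t,U_t,\mathbb G^\alpha(\boldsymbol\mu_t))]$ where $X_0\sim\mu_0$, $U_t\sim\pi_t(\cdot\mid X_t)$, $X_{t+1}\sim P(\cdot\mid X_t,U_t,\mathbb G^\alpha(\boldsymbol\mu_t))$. Lipschitz continuity of $P$ and $r$ refers to all arguments jointly (discrete metric on $\mathcal X,\mathcal U$, $\ell_1$ on $\mathcal B(\mathcal X)$, $\ell_1$/total variation on outputs of $P$). *)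

(* Defs.v *)
From HB Require Import structures.
From mathcomp Require Import all_boot all_order all_algebra.
From mathcomp Require Import all_classical all_reals all_analysis.
Set Implicit Arguments. Unset Strict Implicit. Unset Printing Implicit Defensive.
Import Order.TTheory GRing.Theory Num.Theory.
Local Open Scope classical_set_scope.
Local Open Scope ring_scope.

Section GMFG.
Variables (R : realType) (X U : finType).

(* finite measures on X are vectors X -> R *)
Definition nonneg_vec (g : X -> R) : Prop := forall x, 0 <= g x.
Definition is_prob (g : X -> R) : Prop := nonneg_vec g /\ \sum_x g x = 1.
Definition is_prob_U (g : U -> R) : Prop := (forall u, 0 <= g u) /\ \sum_u g u = 1.
Definition l1 (g : X -> R) : R := \sum_x `|g x|.
Definition ddist {T : eqType} (a b : T) : R := (a != b)%:R.

Definition unit_interval : set R := `[0%R, 1%R]%classic.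

(* a policy: pi t x u = pi_t(u | x) *)
Definition policy := nat -> X -> U -> R.
Definition is_policy (T : nat) (pi : policy) : Prop :=
  forall t x, (t < T)%N -> is_prob_U (pi t x).

Definition policy_ens := R -> policy.
Definition is_policy_ens (T : nat) (pi : policy_ens) : Prop :=
  (forall a, a \in unit_interval -> is_policy T (pi a)) /\
  (forall t x u, (t < T)%N -> measurable_fun unit_interval (fun a => pi a t x u)).

(* mean field ensembles: mu a t x = mu^alpha_t(x) *)
Definition mf_ens := R -> nat -> X -> R.
Definition is_mf_ens (T : nat) (mu : mf_ens) : Prop :=
  (forall a t, a \in unit_interval -> (t < T)%N -> is_prob (mu a t)) /\
  (forall t x, (t < T)%N -> measurable_fun unit_interval (fun a => mu a t x)).

(* neighborhood mean field G^alpha(mu_t) = \int_0^1 W(alpha,beta) mu^beta_t dbeta,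
   where m : R -> X -> R is one time slice beta |-> mu^beta_t *)
Definition Gnb (W : R -> R -> R) (m : R -> X -> R) (a : R) : X -> R :=
  fun x => Rintegral lebesgue_measure unit_interval (fun b => W a b * m b x).

Fixpoint Psi (P : X -> U -> (X -> R) -> X -> R) (W : R -> R -> R) (mu0 : X -> R)
  (pi : policy_ens) (t : nat) : R -> X -> R :=
  match t with
  | 0 => fun _ => mu0
  | t'.+1 => let m := Psi P W mu0 pi t' in
      fun a x => \sum_(x' : X) m a x' *
                 \sum_(u : U) pi a t' x' u * P x' u (Gnb W m a) x
  end.

Fixpoint state_law (P : X -> U -> (X -> R) -> X -> R) (W : R -> R -> R) (mu0 : X -> R)
  (mu : mf_ens) (a : R) (pi : policy) (t : nat) : X -> R :=
  match t with
  | 0 => mu0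
  | t'.+1 => let nu := state_law P W mu0 mu a pi t' in
      fun x => \sum_(x' : X) nu x' *
               \sum_(u : U) pi t' x' u * P x' u (Gnb W (fun b => mu b t') a) x
  end.

(* J^mu_alpha(pi) = E[ sum_{t<T} r(X_t, U_t, G^alpha(mu_t)) ] *)
Definition Jobj (T : nat) (P : X -> U -> (X -> R) -> X -> R) (r : X -> U -> (X -> R) -> R)
  (W : R -> R -> R) (mu0 : X -> R) (mu : mf_ens) (a : R) (pi : policy) : R :=
  \sum_(t < T) \sum_(x : X) state_law P W mu0 mu a pi t x *
     \sum_(u : U) pi t x u * r x u (Gnb W (fun b => mu b t) a).

Definition lipschitz_P (L : R) (P : X -> U -> (X -> R) -> X -> R) : Prop :=
  forall x x' u u' g g', nonneg_vec g -> nonneg_vec g' ->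
    l1 (fun y => P x u g y - P x' u' g' y) <=
    L * (ddist x x' + ddist u u' + l1 (fun y => g y - g' y)).
Definition lipschitz_r (L : R) (r : X -> U -> (X -> R) -> R) : Prop :=
  forall x x' u u' g g', nonneg_vec g -> nonneg_vec g' ->
    `|r x u g - r x' u' g'| <= L * (ddist x x' + ddist u u' + l1 (fun y => g y - g' y)).

End GMFG.
Arguments unit_interval {R}.

Definition lipschitz_W {R : realType} (L : R) (W : R -> R -> R) : Prop :=
  forall a b a' b', a \in unit_interval -> b \in unit_interval ->
    a' \in unit_interval -> b' \in unit_interval ->
    `|W a b - W a' b'| <= L * (`|a - a'| + `|b - b'|).

Definition graphon {R : realType} (W : R -> R -> R) : Prop :=
  (forall a b, a \in unit_interval -> b \in unit_interval -> W a b = W b a) /\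
  (forall a b, a \in unit_interval -> b \in unit_interval -> 0 <= W a b) /\
  measurable_fun (unit_interval `*` unit_interval) (fun p : R * R => W p.1 p.2) /\
  ((@lebesgue_measure R) \x (@lebesgue_measure R))%E.-integrable
     (unit_interval `*` unit_interval) (fun p : R * R => (W p.1 p.2)%:E).

(* Main.v *)
(** The mean field enters the control problem of agent [a] only through the flow [g a] of its neighborhood mean fields, which is Lipschitz in [a]. For a game with finitely many agents [j/N] a Brouwer fixed point, applied to these flows and to a continuous policy that only plays actions within [1/N] of optimality, gives an approximate equilibrium. Along an ultrafilter the flows converge, and the joint state-action laws converge weakly to measures with densities [h] (Radon-Nikodym). Since the initial condition, the evolution and the complementary slackness "law times optimality gap = 0" are linear in the laws, they survive in the limit for almost every agent. Conditioning [h] on the state gives the policies; on the exceptional null set one plays uniformly among the optimal actions, so that optimality holds for every agent.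

Brouwer's theorem is proved on cubes with Kuhn's triangulation: with suitable labels on the boundary there is exactly one boundary door, so the parity argument needs no induction on the dimension. *)
Require Import Defs.
From HB Require Import structures.
From mathcomp Require Import all_boot all_order all_algebra all_fingroup zify ring lra.
From mathcomp Require Import all_classical all_reals all_analysis measurable_realfun.
Set Implicit Arguments. Unset Strict Implicit. Unset Printing Implicit Defensive.
Import Order.TTheory GRing.Theory Num.Theory.
Import numFieldNormedType.Exports.

(** * Kuhn triangulation of the cube *)

(** A fixed-point theorem on the ensembles themselves meets two obstacles: best responses are
    set-valued, and policies are compact in the agent only for weak convergence, which the evolution
    does not respect because it multiplies policy and law. Joint state-action laws absorb that
    product. Their coefficients depend on the flows alone, and the flows are Lipschitz in the agent
    with a constant independent of [N]; hence they converge jointly in the index and the agent, and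
    a strong limit may be multiplied by a weak one. Optimality becomes a linear condition through
    [payoff_gap]: a policy loses exactly the expected sum of its gaps, so it is enough never to play
    an action with positive gap. A flow is an integral over the other agents, so changing policies
    on a null set changes no flow; this is how almost every agent becomes every agent. The
    ultrafilter provides the limits for all agents and all interval ends at once, without extracting
    subsequences. *)

(** Non-fixed points come in pairs [x], [f x]; comparing ranks splits each pair between [L] and [G],
    and [f] maps [L] onto [G]. *)
Lemma odd_card_involution (D : finType) (A : {set D}) (f : D -> D) :
  {in A, forall x, f x \in A} -> {in A, forall x, f (f x) = x} ->
  odd #|A| = odd #|[set x in A | f x == x]|.
Proof.
move=> fA fK; pose lt (x y : D) := (enum_rank x < enum_rank y)%N.
pose L := [set x in A | lt x (f x)]; pose G := [set x in A | lt (f x) x].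
have fL : f @: L = G.
  apply/setP => y; apply/imsetP/idP => [[x]|].
    by rewrite !inE => /andP[xA lx] ->; rewrite fA //= fK.
  by rewrite !inE => /andP[yA ly]; exists (f y); rewrite ?inE ?fA ?fK.
have cLG : #|L| = #|G|.
  rewrite -fL card_in_imset // => x y; rewrite !inE => /andP[xA _] /andP[yA _] e.
  by rewrite -(fK x) // e fK.
rewrite [in LHS](_ : A = [set x in A | f x == x] :|: (L :|: G)); last first.
  apply/setP => x; rewrite !inE -!andb_orr; case: (x \in A) => //=.
  rewrite /lt; case: (ltngtP (enum_rank x) (enum_rank (f x))) => /=; rewrite ?orbT //.
  by move=> /val_inj/enum_rank_inj <-; rewrite eqxx.
rewrite !cardsU.
have -> : L :&: G = finset.set0.
  apply/setP => x; rewrite !inE; case: (x \in A) => //=; apply/negP => /andP[].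
  by rewrite /lt; case: ltngtP.
have -> : [set x in A | f x == x] :&: (L :|: G) = finset.set0.
  apply/setP => x; rewrite !inE; case: (x \in A) => //=.
  by apply/negP => /andP[/eqP ->]; rewrite /lt ltnn.
by rewrite !cards0 !subn0 -cLG addnn oddD odd_double addbF.
Qed.

(** Monotonicity forces [i <= s i], and both sides have the same sum over [i], so no inequality is
    strict. *)
Lemma incr_perm_id n (s : 'S_n) : {homo s : i j / (i < j)%N} -> s = 1%g.
Proof.
move=> sm; have ge (i : 'I_n) : (i <= s i)%N.
  case: i => m; elim: m => [|m IH] lm //.
  have := sm (Ordinal (ltnW lm)) (Ordinal lm) (leqnn _).
  by apply: leq_ltn_trans; exact: IH.
apply/permP => i; rewrite perm1; apply/val_inj/eqP.
have leif (j : 'I_n) : true -> (j <= s j ?= iff (val j == val (s j)))%N.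
  by move=> _; split => //; exact: ge.
have := leqif_sum leif.
have <- : (\sum_(j < n) j = \sum_(j < n) s j)%N.
  by rewrite [LHS](reindex_inj (@perm_inj _ s)).
by case=> _; rewrite eqxx => /esym/forallP/(_ i)/=; rewrite eq_sym.
Qed.

Section Kuhn.
Variables (m k : nat).
Let n := m.+1.
Variable lab : {ffun 'I_n -> nat} -> 'I_n.+1.
Hypothesis k_gt0 : (0 < k)%N.
Hypothesis lab_zero : forall w : {ffun 'I_n -> nat}, (exists j, w j = 0%N) ->
  exists i : 'I_n, [/\ lab w = i :> nat, w i = 0%N & forall j : 'I_n, (j < i)%N -> w j <> 0%N].
Hypothesis lab_top : forall w : {ffun 'I_n -> nat}, (forall j, w j <> 0%N) -> (exists j, w j = k) ->
  lab w = ord_max.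

Let base := {ffun 'I_n -> 'I_k}.

Implicit Types (v : base) (s : 'S_n) (p : base * 'S_n * 'I_n.+1).

(** The [l]-th vertex of a Kuhn simplex: from the corner [v] of a unit cell, one unit step in each
    of the directions [s 0], ..., [s (l-1)]. *)
Definition kuhn_vertex v s (l : nat) : {ffun 'I_n -> nat} :=
  [ffun j => (v j + ((s^-1)%g j < l))%N].

(** The triple [(v, s, i)] stands for the facet opposite to vertex [i], remembered together with the
    side from which it is seen; a door carries every label but the last. *)
Definition kuhn_door p : bool :=
  (fun l : 'I_n => lab (kuhn_vertex p.1.1 p.1.2 (lift p.2 l))) @: finset.setT == [set~ ord_max].

Definition kuhn_up v s (vlt : ((v (s ord0)).+1 < k)%N) : base :=
  [ffun j => if j == s ord0 then Ordinal vlt else v j].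

Lemma pred_lt (x : nat) (lt : (x < k)%N) : (x.-1 < k)%N.
Proof. exact: leq_ltn_trans (leq_pred _) lt. Qed.

Definition kuhn_down v s : base :=
  [ffun j => if j == s ord_max then Ordinal (pred_lt (ltn_ord (v j))) else v j].

Definition ordS_perm : 'S_n := perm (can_inj (@ordSK n)).

(** Crossing a facet into the neighbouring simplex. Dropping the first vertex shifts the cell along
    [s ord0] and makes this direction the last one; dropping the last vertex is the inverse move;
    dropping an inner vertex exchanges two consecutive directions. Facets on the boundary of the
    cube stay fixed. *)
Definition kuhn_pivot p : base * 'S_n * 'I_n.+1 :=
  let: (v, s, i) := p in
  if i == ord0 then
    if ((v (s ord0)).+1 < k)%N =P true is ReflectT vlt
    then (kuhn_up vlt, ordS_perm * s, ord_max)%g else p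
  else if i == ord_max then
    if (0 < v (s ord_max))%N then (kuhn_down v s, ordS_perm^-1 * s, ord0)%g else p
  else (v, tperm (inord i.-1) (inord i) * s, i)%g.

Lemma ordS_permE j : ordS_perm j = ordS j. Proof. by rewrite permE. Qed.

Lemma ordS_max : ordS (ord_max : 'I_n) = ord0.
Proof. by apply/val_inj; rewrite /= modnn. Qed.

Lemma ordS_permV0 : (ordS_perm^-1)%g ord0 = ord_max.
Proof. by apply: (perm_inj (s := ordS_perm)); rewrite permKV ordS_permE ordS_max. Qed.

Lemma ordS_lt (j : 'I_n) : j != ord_max -> ordS j = j.+1 :> nat.
Proof.
move=> jm; rewrite /= modn_small // ltnS ltn_neqAle -ltnS ltn_ord andbT.
by apply: contra jm => /eqP e; apply/eqP/val_inj.
Qed.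

Lemma kuhn_vertex_up v s (vlt : ((v (s ord0)).+1 < k)%N) (l : nat) : (l < n)%N ->
  kuhn_vertex (kuhn_up vlt) (ordS_perm * s)%g l = kuhn_vertex v s l.+1.
Proof.
move=> ln; apply/ffunP => j; rewrite !ffunE invMg permM.
set q := (s^-1)%g j; have -> : j = s q by rewrite permKV.
rewrite (inj_eq (perm_inj (s := s))).
pose q' := (ordS_perm^-1)%g q; have -> : q = ordS q' by rewrite -ordS_permE permKV.
rewrite -ordS_permE permK; have [->|q'm] := eqVneq q' ord_max.
  by rewrite ordS_permE ordS_max eqxx /= [(m < l)%N]ltnNge (_ : (l <= m)%N) // addn0 addn1.
rewrite ordS_permE ordS_lt // ltnS.
case: eqP => // e; suff : ordS q' = 0%N :> nat by rewrite ordS_lt.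
by rewrite e.
Qed.

Lemma kuhn_door_up v s (vlt : ((v (s ord0)).+1 < k)%N) :
  kuhn_door (kuhn_up vlt, ordS_perm * s, ord_max)%g = kuhn_door (v, s, ord0).
Proof.
rewrite /kuhn_door; congr (_ == _); apply: eq_imset => l /=.
by rewrite -kuhn_vertex_up ?ltn_ord //= /bump leqNgt ltn_ord.
Qed.

Lemma kuhn_down_lt v s : (0 < v (s ord_max))%N ->
  ((kuhn_down v s ((ordS_perm^-1 * s)%g ord0)).+1 < k)%N.
Proof. by move=> v0; rewrite ffunE permM ordS_permV0 eqxx /= prednK. Qed.

Lemma kuhn_downK v s (v0 : (0 < v (s ord_max))%N) : kuhn_up (kuhn_down_lt v0) = v.
Proof.
apply/ffunP => j; apply/val_inj; rewrite ffunE (fun_if val) /= !ffunE permM ordS_permV0 eqxx /=.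
by case: eqP => [->|//]; rewrite prednK.
Qed.

Lemma kuhn_upK v s (vlt : ((v (s ord0)).+1 < k)%N) :
  kuhn_down (kuhn_up vlt) (ordS_perm * s)%g = v.
Proof.
apply/ffunP => j; apply/val_inj.
rewrite ffunE (fun_if val) /= !ffunE permM ordS_permE ordS_max (fun_if val) /=.
by case: eqP => [->|//].
Qed.

Lemma kuhn_pivot_down v s : (0 < v (s ord_max))%N ->
  kuhn_pivot (v, s, ord_max) = (kuhn_down v s, ordS_perm^-1 * s, ord0)%g.
Proof. by move=> v0; rewrite /kuhn_pivot /= eqxx v0. Qed.

Lemma kuhn_pivot_up v s (vlt : ((v (s ord0)).+1 < k)%N) :
  kuhn_pivot (v, s, ord0) = (kuhn_up vlt, ordS_perm * s, ord_max)%g.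
Proof.
rewrite /kuhn_pivot /=; case: eqP => [vlt'|/(_ vlt)//].
by rewrite (bool_irrelevance vlt' vlt).
Qed.

Lemma inner_ord (i : 'I_n.+1) : i != ord0 -> i != ord_max -> (0 < i < n)%N.
Proof.
move=> i0 im; apply/andP; split.
  by rewrite lt0n; apply: contra i0 => /eqP e; apply/eqP/val_inj.
by rewrite ltn_neqAle -ltnS ltn_ord andbT; apply: contra im => /eqP e; apply/eqP/val_inj.
Qed.

(** Exchanging the directions at positions [i-1] and [i] alters only the vertex reached between
    these two steps, which is vertex [i]. *)
Lemma kuhn_vertex_swap v s (i l : 'I_n.+1) : i != ord0 -> i != ord_max -> l != i ->
  kuhn_vertex v (tperm (inord i.-1) (inord i) * s)%g l = kuhn_vertex v s l.
Proof.
move=> i0 im li; apply/ffunP => j; rewrite !ffunE invMg permM tpermV.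
have /andP[i_gt0 iln] := inner_ord i0 im.
have lni : (l : nat) != i by [].
by congr (_ + nat_of_bool _)%N; case: tpermP => [->|->|//]; rewrite !inordK //; lia.
Qed.

Lemma kuhn_door_swap v s (i : 'I_n.+1) : i != ord0 -> i != ord_max ->
  kuhn_door (v, tperm (inord i.-1) (inord i) * s, i)%g = kuhn_door (v, s, i).
Proof.
move=> i0 im; rewrite /kuhn_door; congr (_ == _); apply: eq_imset => l.
by apply: (congr1 lab); apply: kuhn_vertex_swap; rewrite // eq_sym neq_lift.
Qed.

Lemma kuhn_pivotK p : kuhn_pivot (kuhn_pivot p) = p.
Proof.
case: p => [[v s] i]; have [->|i0] := eqVneq i ord0.
  case: (boolP ((v (s ord0)).+1 < k)%N) => [vlt|nvlt].
    rewrite (kuhn_pivot_up vlt) kuhn_pivot_down ?permM ?ordS_permE ?ordS_max ?ffunE ?eqxx //.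
    by rewrite kuhn_upK mulKg.
  have -> : kuhn_pivot (v, s, ord0) = (v, s, ord0).
    by rewrite /kuhn_pivot /=; case: eqP => // vlt; rewrite vlt in nvlt.
  by rewrite /kuhn_pivot /=; case: eqP => // vlt; rewrite vlt in nvlt.
have [->|im] := eqVneq i ord_max.
  case: (posnP (v (s ord_max))) => [v0|v0].
    by rewrite /kuhn_pivot /= eqxx v0 /= eqxx v0.
  by rewrite kuhn_pivot_down // (kuhn_pivot_up (kuhn_down_lt v0)) kuhn_downK mulKVg.
by rewrite /kuhn_pivot (negbTE i0) (negbTE im) (negbTE i0) (negbTE im) mulgA tperm2 mul1g.
Qed.

Lemma kuhn_pivot_door p : kuhn_door (kuhn_pivot p) = kuhn_door p.
Proof.
case: p => [[v s] i]; have [->|i0] := eqVneq i ord0.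
  rewrite /kuhn_pivot /=; case: eqP => // vlt; exact: kuhn_door_up.
have [->|im] := eqVneq i ord_max.
  case: (posnP (v (s ord_max))) => [v0|v0]; first by rewrite /kuhn_pivot /= eqxx v0.
  by rewrite kuhn_pivot_down // -(kuhn_door_up (kuhn_down_lt v0)) kuhn_downK mulKVg.
by rewrite /kuhn_pivot (negbTE i0) (negbTE im) kuhn_door_swap.
Qed.

Let k0 : 'I_k := Ordinal k_gt0.
Definition kuhn_start : base * 'S_n * 'I_n.+1 := ([ffun=> k0], 1%g, ord_max).

Lemma kuhn_door_label p (c : 'I_n) : kuhn_door p ->
  exists l : 'I_n, lab (kuhn_vertex p.1.1 p.1.2 (lift p.2 l)) = c :> nat.
Proof.
move=> /eqP/setP/(_ (widen_ord (leqnSn n) c)); rewrite !inE.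
have -> : widen_ord (leqnSn n) c != ord_max.
  by apply/eqP => /(congr1 val) /= e; have := ltn_ord c; rewrite e ltnn.
by move=> /imsetP[l _ e]; exists l; rewrite -e.
Qed.

Lemma lift_max_nat (l : 'I_n) : lift ord_max l = l :> nat.
Proof. by rewrite /= /bump leqNgt ltn_ord. Qed.

(** Vertex [l] of the standard chain at the origin has ones before coordinate [l] and zeros from
    there on, so its label, the first zero coordinate, is [l]. *)
Lemma kuhn_start_door : kuhn_door kuhn_start.
Proof.
have labE (l : 'I_n) : lab (kuhn_vertex [ffun=> k0] 1%g l) = l :> nat.
  have [|i [-> ]] := lab_zero (w := kuhn_vertex [ffun=> k0] 1%g l).
    by exists l; rewrite !ffunE invg1 perm1 ltnn.
  rewrite !ffunE invg1 perm1 /=; case: ltngtP => //= li _ /(_ l li).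
  by rewrite !ffunE invg1 perm1 ltnn.
apply/eqP/setP => c; rewrite !inE; apply/imsetP/idP => [[l _ ->]|cm].
  rewrite lift_max_nat; apply/eqP => /(congr1 (@nat_of_ord _)); rewrite labE /= => e.
  by have := ltn_ord l; rewrite e ltnn.
have cn : (c < n)%N.
  by rewrite ltn_neqAle -ltnS ltn_ord andbT; apply: contra cm => /eqP e; apply/eqP/val_inj.
by exists (Ordinal cn) => //; apply/ord_inj; rewrite lift_max_nat (labE (Ordinal cn)).
Qed.

(* The vertices of the facet all lie on the face [w (s ord_max) = 0]; since they increase along the chain, seeing all labels forces the standard facet. *)
Lemma kuhn_bottom_door v s : kuhn_door (v, s, ord_max) -> v (s ord_max) = 0%N :> nat ->
  (v, s, ord_max) = kuhn_start.
Proof.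
move=> d v0; have key (c : 'I_n) : exists l : 'I_n,
    kuhn_vertex v s l c = 0%N /\ forall j : 'I_n, (j < c)%N -> kuhn_vertex v s l j <> 0%N.
  have [l lE] := kuhn_door_label c d; exists l; move: lE; rewrite /= /bump leqNgt ltn_ord add0n.
  have [|i [-> wi wj] e] := lab_zero (w := kuhn_vertex v s l).
    by exists (s ord_max); rewrite !ffunE permK v0 add0n ltnNge -ltnS ltn_ord.
  by have <- : i = c by apply/val_inj.
have vz c : v c = k0.
  have [l [+ _]] := key c; rewrite ffunE => /eqP; rewrite addn_eq0 => /andP[/eqP e _].
  exact/val_inj.
suff e : (s^-1)%g = 1%g.
  rewrite /kuhn_start; congr (_, _, _); first by apply/ffunP => c; rewrite ffunE vz.
  by apply: invg_inj; rewrite e invg1.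
(* The vertex labelled [j] has not yet moved in direction [j] but has moved in every direction
   [i < j], so [i] precedes [j] in the chain. *)
apply: incr_perm_id => i j ij; have [l [+ /(_ _ ij)]] := key j.
rewrite !ffunE !vz /= !add0n; case: (ltnP ((s^-1)%g j) l) => // jl _.
by case: (ltnP ((s^-1)%g i) l) => // il _; exact: leq_trans il jl.
Qed.

(** Only boundary facets are fixed. On a top face, coordinate [s ord0] equals [k] at all vertices,
    so label [s ord0] cannot occur and there is no door; the bottom faces are settled by
    [kuhn_bottom_door]. *)
Lemma kuhn_pivot_fixed p : kuhn_door p -> kuhn_pivot p = p -> p = kuhn_start.
Proof.
case: p => [[v s] i]; have [->|i0] := eqVneq i ord0.
  move=> d; rewrite /kuhn_pivot /=; case: eqP => [vlt [_ _]//|/negP nvlt _].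
  have vk : (v (s ord0)).+1 = k by apply/eqP; rewrite eqn_leq ltn_ord leqNgt.
  have [l] := kuhn_door_label (s ord0) d.
  have topl : kuhn_vertex v s (lift ord0 l) (s ord0) = k by rewrite ffunE permK /= addn1.
  have [/existsP[j /eqP wj]|/existsPn nz] :=
    boolP [exists j, kuhn_vertex v s (lift ord0 l) j == 0%N].
    have [|i' [-> wi _ /val_inj e]] := lab_zero (w := kuhn_vertex v s (lift ord0 l)).
      by exists j.
    by move: wi; rewrite e topl; case: k k_gt0.
  rewrite lab_top /=; first by move=> e; have := ltn_ord (s ord0); rewrite -e ltnn.
    by move=> j; apply/eqP.
  by exists (s ord0).
have [->|im] := eqVneq i ord_max.
  case: (posnP (v (s ord_max))) => [v0 d _|v0 d]; first exact: kuhn_bottom_door.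
  by rewrite kuhn_pivot_down // => -[_ _].
have /andP[i_gt0 iln] := inner_ord i0 im.
move=> _; rewrite /kuhn_pivot (negbTE i0) (negbTE im) => -[].
move/(canRL (mulgK s)); rewrite mulgV => /permP/(_ (inord i)).
rewrite perm1 tpermR => /(congr1 val); rewrite /= !inordK; lia.
Qed.

Lemma kuhn_door_fixed : [set p in [set p | kuhn_door p] | kuhn_pivot p == p] = [set kuhn_start].
Proof.
apply/setP => p; rewrite !inE; apply/andP/eqP => [[d /eqP]|->]; first exact: kuhn_pivot_fixed.
by split; [exact: kuhn_start_door | rewrite /kuhn_pivot /= eqxx ffunE].
Qed.

Lemma kuhn_doorE v s i : kuhn_door (v, s, i) =
  ((fun l : 'I_n.+1 => lab (kuhn_vertex v s l)) @: [set~ i] == [set~ ord_max]).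
Proof.
rewrite /kuhn_door; congr (_ == _); apply/setP => c; apply/imsetP/imsetP => -[l li ->].
  by exists (lift i l) => //; rewrite !inE eq_sym neq_lift.
by rewrite !inE eq_sym in li; case: (unlift_some li) => j e _; exists j; rewrite // e.
Qed.

(** Without a fully labelled simplex each simplex containing a door contains exactly two, and [swap]
    is an involution of the doors without fixed point. Their number would be even, whereas
    [kuhn_pivot] has a single fixed door and makes it odd. *)
Lemma kuhn_complete : exists v s, forall c, exists l : 'I_n.+1, lab (kuhn_vertex v s l) = c.
Proof.
pose L v s (l : 'I_n.+1) := lab (kuhn_vertex v s l).
have [/existsP[v /existsP[s /forallP h]]|nocomp] :=
  boolP [exists v : base, [exists s : 'S_n, [forall c, [exists l, L v s l == c]]]].
  by exists v, s => c; have /existsP[l /eqP e] := h c; exists l.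
pose swap p : base * 'S_n * 'I_n.+1 := let: (v, s, i) := p in
  (v, s, odflt i [pick j | (j != i) && (L v s j == L v s i)]).
(* A door has as many vertices as labels, so labels are injective on it; hence the vertex repeating
   the label of [i] is unique. *)
have inj v s i : kuhn_door (v, s, i) -> {in [set~ i] &, injective (L v s)}.
  rewrite kuhn_doorE => /eqP e; apply/imset_injP; rewrite e.
  by rewrite !cardsC1.
have swapE v s i : kuhn_door (v, s, i) -> exists j,
    [/\ j != i, L v s j = L v s i & swap (v, s, i) = (v, s, j)].
  move=> d; rewrite /swap; case: pickP => [j /andP[ji /eqP e]|no]; first by exists j.
  case/negP: nocomp; apply/existsP; exists v; apply/existsP; exists s; apply/forallP => c.
  move: d; rewrite kuhn_doorE => /eqP/setP E.
  have [->|cm] := eqVneq c ord_max; last first.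
    by have := E c; rewrite !inE cm => /imsetP[l _ ->]; apply/existsP; exists l.
  apply/existsP; exists i; apply/negPn/negP => nm.
  have := E (L v s i); rewrite !inE nm => /imsetP[l]; rewrite !inE => li e.
  by have := no l; rewrite li [L v s i]e eqxx.
have swap_door : {in [set p | kuhn_door p], forall p, swap p \in [set p | kuhn_door p]}.
  move=> [[v s] i]; rewrite !inE => d; have [j [ji Lji ->]] := swapE _ _ _ d.
  move: d; rewrite !kuhn_doorE => /eqP <-; apply/eqP/setP => c.
  apply/imsetP/imsetP => -[l]; rewrite !inE => lx ->.
    have [->|li] := eqVneq l i; last by exists l; rewrite ?inE.
    by exists j; rewrite ?inE //; exact/esym.
  have [->|lj] := eqVneq l j; last by exists l; rewrite ?inE.
  by exists i; rewrite ?inE // eq_sym.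
have swapK : {in [set p | kuhn_door p], forall p, swap (swap p) = p}.
  move=> [[v s] i] din; have := swap_door _ din; move: din; rewrite !inE => d.
  have [j [ji Lji ->]] := swapE _ _ _ d => d'; have [i' [i'j Li'j ->]] := swapE _ _ _ d'.
  congr (_, _, _); apply/eqP/negPn/negP => i'i.
  by case/eqP: i'j; apply: (inj _ _ _ d); rewrite ?inE.
have := odd_card_involution swap_door swapK.
have -> : [set p in [set p | kuhn_door p] | swap p == p] = finset.set0.
  apply/setP => -[[v s] i]; rewrite !inE; apply/negP => /andP[d].
  by have [j [ji _ ->]] := swapE _ _ _ d; rewrite /= => /eqP[e]; rewrite e eqxx in ji.
rewrite cards0 (odd_card_involution (f := kuhn_pivot)) ?kuhn_door_fixed ?cards1 //.
- by move=> p; rewrite !inE kuhn_pivot_door.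
- by move=> p _; exact: kuhn_pivotK.
Qed.
End Kuhn.

Local Open Scope classical_set_scope.
Local Open Scope ring_scope.

(** * Brouwer fixed points *)

Lemma ultra_nat : exists U : set_system nat, UltraFilter U /\ \oo `<=` U.
Proof. exact: ultraFilterLemma. Qed.

(** By compactness there is a cluster point, and a cluster point of an ultrafilter is a limit. *)
Lemma ultra_cvg (R : realType) (U : set_system nat) (u : nat -> R) (a b : R) :
  UltraFilter U -> (forall n, a <= u n <= b) ->
  exists2 l, a <= l <= b & u @ U --> l.
Proof.
move=> UU uab; have Uab : (u @ U) `[a, b]%classic.
  by apply: (@filterE _ U) => n; rewrite /= in_itv /= uab.
have [l [/= lab cl]] := @segment_compact R a b (u @ U) _ Uab.
exists l; first by rewrite in_itv /= in lab.
move=> A lA; have [//|UnA] := in_ultra_setVsetC (u @^-1` A) UU.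
by have [x [nAx Ax]] := cl (~` A) A UnA lA.
Qed.

Lemma cvg_fsum (R : realType) (I : Type) (r : seq I) (T : Type) (F : set_system T) {FF : Filter F}
    (f : I -> T -> R) (l : I -> R) :
  (forall i, f i x @[x --> F] --> l i) ->
  \sum_(i <- r) f i x @[x --> F] --> \sum_(i <- r) l i.
Proof.
move=> fl; elim: r => [|i r IH].
  by rewrite big_nil; under eq_fun do rewrite big_nil; exact: cvg_cst.
by rewrite big_cons; under eq_fun do rewrite big_cons; apply: cvgD.
Qed.

Lemma cvg_fprod (R : realType) (I : Type) (r : seq I) (T : Type) (F : set_system T) {FF : Filter F}
    (f : I -> T -> R) (l : I -> R) :
  (forall i, f i x @[x --> F] --> l i) ->
  \prod_(i <- r) f i x @[x --> F] --> \prod_(i <- r) l i.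
Proof.
move=> fl; elim: r => [|i r IH].
  by rewrite big_nil; under eq_fun do rewrite big_nil; exact: cvg_cst.
by rewrite big_cons; under eq_fun do rewrite big_cons; apply: cvgM.
Qed.

Lemma cvg_max (R : realType) (T : Type) (F : set_system T) {FF : Filter F} (f g : T -> R) (a b : R) :
  f x @[x --> F] --> a -> g x @[x --> F] --> b ->
  Num.max (f x) (g x) @[x --> F] --> Num.max a b.
Proof.
move=> fa gb; rewrite maxr_absE; under eq_fun do rewrite maxr_absE.
by apply: cvgM; [apply: cvgD; [exact: cvgD|apply: cvg_norm; exact: cvgB]|exact: cvg_cst].
Qed.

Lemma cvg_min (R : realType) (T : Type) (F : set_system T) {FF : Filter F} (f g : T -> R) (a b : R) :
  f x @[x --> F] --> a -> g x @[x --> F] --> b ->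
  Num.min (f x) (g x) @[x --> F] --> Num.min a b.
Proof.
move=> fa gb; rewrite minr_absE; under eq_fun do rewrite minr_absE.
by apply: cvgM; [apply: cvgB; [exact: cvgD|apply: cvg_norm; exact: cvgB]|exact: cvg_cst].
Qed.

Lemma cvg_dist_le (R : realType) (S : Type) (F : set_system S) {FF : Filter F}
    (f e : S -> R) (l : R) :
  (forall n, `|f n - l| <= e n) -> e n @[n --> F] --> (0 : R) -> f n @[n --> F] --> l.
Proof.
move=> fe e0; have d0 : (fun n => f n - l) @ F --> (0 : R).
  apply/norm_cvg0P; apply: (squeeze_cvgr (f := fun=> 0) (h := e)) => //.
  - by apply: filterE => n; rewrite normr_ge0 fe.
  - exact: cvg_cst.
have -> : f = (fun n => (f n - l) + l) by apply/funext => n; rewrite subrK.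
by rewrite -[X in _ --> X]add0r; apply: cvgD => //; exact: cvg_cst.
Qed.

Lemma cvg_inv_nat (R : realType) (U : set_system nat) : \oo `<=` U ->
  (n.+1%:R^-1 : R) @[n --> U] --> (0 : R).
Proof. by move=> oU; apply: cvg_trans (@cvg_harmonic R); exact: cvg_app. Qed.

(** Label a grid point by its first zero coordinate if there is one, otherwise by a coordinate that
    [g] strictly increases, otherwise by [ord_max]. A fully labelled simplex then has, for each
    coordinate, a vertex where [g] does not decrease it, and one vertex where [g] increases none. *)
Lemma kuhn_approx (R : realType) (m K : nat) (g : ('I_m.+1 -> R) -> 'I_m.+1 -> R) :
  let close (x y : 'I_m.+1 -> R) := forall j, 0 <= y j <= 2 /\ `|y j - x j| <= K.+1%:R^-1 in
  (forall z : 'I_m.+1 -> R, (forall j, 0 <= z j <= 2) -> forall j, 0 <= g z j) ->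
  (forall z : 'I_m.+1 -> R, (forall j, 0 <= z j <= 2) -> (exists j, z j = 2) -> forall j, g z j <= 0) ->
  exists x : 'I_m.+1 -> R, [/\ forall j, 0 <= x j <= 2,
    forall c, exists2 y, close x y & y c <= g y c &
    exists2 y, close x y & forall j, g y j <= y j].
Proof.
move=> close g0 g2; pose k := (K.+1).*2.
pose pt (w : {ffun 'I_m.+1 -> nat}) (j : 'I_m.+1) : R := (w j)%:R / K.+1%:R.
pose wid := widen_ord (leqnSn m.+1).
pose lab (w : {ffun 'I_m.+1 -> nat}) : 'I_m.+2 := match [pick j | w j == 0%N] with
  | Some j0 => wid [arg min_(i < j0 | w i == 0%N) i]
  | None => match [pick j | pt w j < g (pt w) j] with Some j => wid j | None => ord_max end
  end.
have K0 : (0 : R) < K.+1%:R by rewrite ltr0n.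
have ptb (w : {ffun 'I_m.+1 -> nat}) : (forall j, w j <= k)%N -> forall j, 0 <= pt w j <= 2.
  move=> wk j; rewrite /pt divr_ge0 ?ler0n //= ler_pdivrMr // -natrM ler_nat.
  by rewrite mul2n wk.
(* [kuhn_complete] asks its label conditions of all integer points, also outside the cube, so labels
   are read after truncation at [k]. *)
pose cut (w : {ffun 'I_m.+1 -> nat}) : {ffun 'I_m.+1 -> nat} := finfun (fun j => minn k (w j)).
have cutk (w : {ffun 'I_m.+1 -> nat}) j : (cut w j <= k)%N by rewrite ffunE geq_minl.
have k0 : (0 < k)%N by rewrite double_gt0.
have ptk (w : {ffun 'I_m.+1 -> nat}) j : w j = k -> pt w j = 2.
  by move=> wk; rewrite /pt wk /k -muln2 natrM mulrAC divff ?mul1r // lt0r_neq0.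
have labz (w : {ffun 'I_m.+1 -> nat}) : (exists j, w j = 0%N) -> exists i : 'I_m.+1,
    [/\ lab w = i :> nat, w i = 0%N & forall j : 'I_m.+1, (j < i)%N -> w j <> 0%N].
  move=> [j wj]; rewrite /lab; case: pickP => [j0 wj0|/(_ j)]; last by rewrite wj.
  case: arg_minnP => // i /eqP wi imin; exists i; split=> // j' j'i /eqP /imin.
  by rewrite leqNgt j'i.
have [||v [s h]] := @kuhn_complete m k (fun w => lab (cut w)) k0.
- move=> w [j wj]; have [|i [li ci cj]] := labz (cut w).
    by exists j; rewrite ffunE wj minn0.
  exists i; split => //; first by move: ci; rewrite ffunE; lia.
  by move=> j' /cj + wj'; apply; rewrite ffunE wj' minn0.
- move=> w wnz [j wj]; rewrite /lab; case: pickP => [j0 /eqP|_].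
    by rewrite ffunE; have := wnz j0; lia.
  (* On an upper face [g] is nonpositive and grid coordinates are nonnegative, so the strict test
     fails and the label is [ord_max]. *)
  case: pickP => // j0; suff gle : g (pt (cut w)) j0 <= 0.
    by move/lt_le_trans => /(_ _ gle); rewrite ltNge divr_ge0 // ler0n.
  apply: g2; first exact: ptb.
  by exists j; apply: ptk; rewrite ffunE wj minnn.
have vle l j : (kuhn_vertex v s l j <= k)%N.
  by rewrite ffunE; have := ltn_ord (v j); case: (_ < l)%N; lia.
have cutv l : cut (kuhn_vertex v s l) = kuhn_vertex v s l.
  by apply/ffunP => j; rewrite [LHS]ffunE; apply/minn_idPr.
pose x (j : 'I_m.+1) : R := (v j)%:R / K.+1%:R.
have xle j : 0 <= x j <= 2.
  have -> : x j = pt [ffun j => nat_of_ord (v j)] j by rewrite /pt ffunE.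
  by apply: ptb => i; rewrite ffunE ltnW.
have cl l : close x (pt (kuhn_vertex v s l)).
  move=> j; split; first exact: ptb.
  rewrite /pt ffunE /x natrD mulrDl addrC addKr; case: (_ < l)%N.
    by rewrite mul1r ger0_norm // invr_ge0 ltW.
  by rewrite mul0r normr0 invr_ge0 ltW.
exists x; split => //.
- move=> c; have [l] := h (wid c); rewrite cutv => e.
  exists (pt (kuhn_vertex v s l)) => //.
  move: e; set w := kuhn_vertex v s l.
  have [/existsP[j0 /eqP wj0] e|/existsPn nz] := boolP [exists j, w j == 0%N].
    have [|i [li wi _]] := labz w; first by exists j0.
    have -> : c = i by apply/ord_inj; rewrite -li e.
    by rewrite {1}/pt wi mul0r; apply: g0; apply: ptb; exact: vle.
  rewrite /lab; case: pickP => [j0|_]; first by rewrite (negbTE (nz j0)).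
  case: pickP => [j lt /(congr1 (@nat_of_ord _)) /= /ord_inj <-|_ e]; first exact: ltW.
  by have := ltn_ord c; have /= <- := congr1 (@nat_of_ord _) e; rewrite ltnn.
- have [l] := h ord_max; rewrite cutv => e.
  exists (pt (kuhn_vertex v s l)) => // j.
  move: e; set w := kuhn_vertex v s l; rewrite /lab.
  have widm i : wid i <> ord_max.
    by move=> /(congr1 (@nat_of_ord _)) /= e; have := ltn_ord i; rewrite e ltnn.
  case: pickP => [j0 _ /widm//|_]; case: pickP => [j0 _ /widm//|/(_ j)].
  by rewrite leNgt => ->.
Qed.

(** Tested along every proper filter on the indices, so that it applies to the ultrafilter limit of
    approximate fixed points. *)
Definition seq_continuous (R : realType) (I : Type) (f : (I -> R) -> I -> R) (B : set (I -> R)) :=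
  forall (U : set_system nat) (u : nat -> I -> R) (z : I -> R), ProperFilter U ->
    (forall n, B (u n)) -> B z -> (forall i, u n i @[n --> U] --> z i) ->
    forall i, f (u n) i @[n --> U] --> f z i.

Definition cube (R : realType) (I : Type) (M : R) : set (I -> R) :=
  [set z | forall i, 0 <= z i <= M].

(* [f] is extended to the cube [0, 2]^n, damped so as to vanish on the upper faces: this provides the boundary labels of [kuhn_complete]. *)
Lemma brouwer_ord (R : realType) (m : nat) (f : ('I_m.+1 -> R) -> 'I_m.+1 -> R) :
  (forall z, cube 1 z -> cube 1 (f z)) -> seq_continuous f (cube 1) ->
  exists2 z, cube 1 z & f z = z.
Proof.
move=> f01 fc; have [U [UU oU]] := ultra_nat.
pose cl (z : 'I_m.+1 -> R) j := Num.min (z j) 1.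
(* The damping factor is 1 on the unit cube and 0 as soon as some coordinate equals 2. *)
pose lam (z : 'I_m.+1 -> R) := \prod_j Num.max 0 (Num.min 1 (2 - z j)).
pose g z j := lam z * f (cl z) j.
have clb z : cube 2 z -> cube 1 (cl z).
  move=> zb i; have /andP[z0 _] := zb i.
  by rewrite /cl ge_min lexx orbT le_min z0 ler01.
have lam0 z : 0 <= lam z by apply: prodr_ge0 => i _; rewrite le_max lexx.
have lam1 z : lam z <= 1.
  by apply: prodr_ile1 => i; rewrite le_max lexx /= ge_max ler01 ge_min lexx.
have gb z : cube 2 z -> cube 1 (g z).
  move=> zb i; have /andP[f0 f1] := f01 _ (clb _ zb) i.
  by rewrite mulr_ge0 //= mulr_ile1.
have glim (u : nat -> 'I_m.+1 -> R) z : (forall n, cube 2 (u n)) -> cube 2 z ->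
    (forall i, u n i @[n --> U] --> z i) -> forall i, g (u n) i @[n --> U] --> g z i.
  move=> ub zb uz i; apply: cvgM.
    apply: cvg_fprod => j; apply: cvg_max; first exact: cvg_cst.
    by apply: cvg_min; [exact: cvg_cst|apply: cvgB; [exact: cvg_cst|exact: uz]].
  apply: fc => [n||j]; [exact: clb|exact: clb|].
  by apply: cvg_min; [exact: uz|exact: cvg_cst].
have g2 z : (forall j, 0 <= z j <= 2) -> (exists j, z j = 2) -> forall j, g z j <= 0.
  move=> zb [j zj] i; rewrite /g /lam (bigD1 j) //= zj subrr minC.
  by rewrite (min_idPl ler01) maxxx !mul0r.
have /choice[x xP] N := @kuhn_approx R m N g (fun z zb j => proj1 (andP (gb z zb j))) g2.
have xb n : cube 2 (x n) by have [] := xP n.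
have /choice[z zP] i : exists l : R, 0 <= l <= 2 /\ x n i @[n --> U] --> l.
  by have [l lb xl] := ultra_cvg (u := fun n => x n i) (a := 0) (b := 2) UU (fun n => xb n i); exists l.
have zb : cube 2 z by move=> i; have [] := zP i.
have ylim (y : nat -> 'I_m.+1 -> R) :
    (forall n j, 0 <= y n j <= 2 /\ `|y n j - x n j| <= n.+1%:R^-1) ->
    forall i, y n i @[n --> U] --> z i.
  move=> yx i; have [_ xz] := zP i.
  have d0 : (fun n => y n i - x n i) @ U --> (0 : R).
    apply/norm_cvg0P; apply: (squeeze_cvgr (f := fun=> 0) (h := fun n => n.+1%:R^-1)).
    - by apply: filterE => n; rewrite normr_ge0; have [_] := yx n i.
    - exact: cvg_cst.
    - exact: cvg_inv_nat.
  have -> : (fun n => y n i) = (fun n => (y n i - x n i) + x n i).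
    by apply/funext => n; rewrite subrK.
  by rewrite -(add0r (z i)); exact: cvgD.
have gz i : g z i = z i.
  apply/eqP; rewrite eq_le; apply/andP; split.
    have /choice[y yP] n : exists y : 'I_m.+1 -> R, (forall j, 0 <= y j <= 2 /\ `|y j - x n j| <= n.+1%:R^-1) /\
      forall j, g y j <= y j by have [_ _ [y]] := xP n; exists y.
    have yb n : cube 2 (y n) by move=> j; have [/(_ j)[]] := yP n.
    have yz := ylim y (fun n => proj1 (yP n)).
    apply: (ler_cvg_to (glim y z yb zb yz i) (yz i)).
    by apply: filterE => n; have [_] := yP n.
  have /choice[y yP] n : exists y : 'I_m.+1 -> R, (forall j, 0 <= y j <= 2 /\ `|y j - x n j| <= n.+1%:R^-1) /\
    y i <= g y i by have [_ /(_ i)[y] cy yi _] := xP n; exists y.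
  have yb n : cube 2 (y n) by move=> j; have [/(_ j)[]] := yP n.
  have yz := ylim y (fun n => proj1 (yP n)).
  apply: (ler_cvg_to (yz i) (glim y z yb zb yz i)).
  by apply: filterE => n; have [_] := yP n.
(* A fixed point of [g] is bounded by a value of [f], hence lies in the unit cube, where neither the
   truncation nor the damping acts. *)
have z1 : cube 1 z.
  move=> i; have /andP[-> _] /= := zb i; rewrite -gz.
  by have /andP[_ ?] := f01 _ (clb _ zb) i; rewrite mulr_ile1 //; have /andP[] := f01 _ (clb _ zb) i.
exists z => //; apply/funext => i; rewrite -[RHS]gz /g.
have -> : cl z = z by apply/funext => j; apply/min_idPl; have /andP[] := z1 j.
rewrite /lam big1 ?mul1r // => j _; have /andP[_ zj] := z1 j.
by rewrite (min_idPl _) ?(max_idPr _) // lerBrDr; lra.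
Qed.

Lemma brouwer (R : realType) (I : finType) (M : R) (f : (I -> R) -> I -> R) : 0 < M ->
  (forall z, cube M z -> cube M (f z)) -> seq_continuous f (cube M) ->
  exists2 z, cube M z & f z = z.
Proof.
move=> M0 fM fc; case: (posnP #|I|) => [/card0_eq I0|].
  by exists (fun=> 0) => [i|]; [|apply/funext => i]; have := I0 i.
case cI : #|I| => [//|m] _; pose rk i : 'I_m.+1 := cast_ord cI (enum_rank i).
pose vl j : I := enum_val (cast_ord (esym cI) j).
have rkK i : vl (rk i) = i by rewrite /vl /rk cast_ordK enum_rankK.
have vlK j : rk (vl j) = j by rewrite /vl /rk enum_valK cast_ordKV.
pose up (w : 'I_m.+1 -> R) i : R := M * w (rk i).
have upM w : cube 1 w -> cube M (up w).
  by move=> wb i; have /andP[w0 w1] := wb (rk i); rewrite mulr_ge0 ?(ltW M0) //= ler_piMr // ltW.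
have [|U u w UF ub wb uw j|w wb ew] := @brouwer_ord R m (fun w j => f (up w) (vl j) / M).
- move=> w wb j; have /andP[f0 f1] := fM _ (upM _ wb) (vl j).
  by rewrite divr_ge0 ?(ltW M0) //= ler_pdivrMr // mul1r.
- apply: cvgM; last exact: cvg_cst.
  apply: fc => [n||i]; [exact: upM|exact: upM|].
  by apply: cvgM; [exact: cvg_cst|exact: uw].
- exists (up w); first exact: upM.
  have wE i : w (rk i) = f (up w) i / M by rewrite -{1}ew rkK.
  by apply/funext => i; rewrite {2}/up wE mulrC divfK // gt_eqF.
Qed.

(** * Weak limits of measures on grids *)

Section density.
Context {R : realType}.
Variable Phi : R -> R.
Hypothesis Phi_incr : forall a b, a <= b -> 0 <= Phi b - Phi a <= b - a.

Let lip1_continuous (f : R -> R) : (forall a b, a <= b -> 0 <= f b - f a <= b - a) -> continuous f.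
Proof.
move=> fl x; apply/cvgrPdist_le => e e0; near=> y.
have yx : `|x - y| <= e by near: y; exact: cvgr_dist_le.
apply: le_trans yx; case: (leP x y) => [xy|/ltW yx].
  have /andP[? ?] := fl _ _ xy; rewrite distrC ger0_norm // distrC ger0_norm //.
  by rewrite subr_ge0.
by have /andP[? ?] := fl _ _ yx; rewrite ger0_norm // ger0_norm // subr_ge0.
Unshelve. all: by end_near. Qed.

Let ncumul (f : R -> R) (fl : forall a b, a <= b -> 0 <= f b - f a <= b - a) :
  nondecreasing f.
Proof. by move=> a b /fl /andP[+ _]; rewrite subr_ge0. Qed.

Let cPhi : cumulative R R :=
  HB.pack Phi (isCumulative.Build R _ R Phi (ncumul Phi_incr)
    (right_continuousW (lip1_continuous Phi_incr))).

Let compl_incr a b : a <= b -> 0 <= (b - Phi b) - (a - Phi a) <= b - a.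
Proof. by move=> /Phi_incr /andP[? ?]; apply/andP; split; lra. Qed.

Let cCompl : cumulative R R :=
  HB.pack (fun x => x - Phi x) (isCumulative.Build R _ R (fun x => x - Phi x) (ncumul compl_incr)
    (right_continuousW (lip1_continuous compl_incr))).

Local Notation lsm := lebesgue_stieltjes_measure.

Let lsm_oc (f : cumulative R R) a b : a <= b ->
  lsm f `]a, b]%classic = (f b - f a)%:E.
Proof.
move=> ab; rewrite /lsm /measure_extension measurable_mu_extE; last exact: is_ocitv.
by rewrite /= wlength_itv_bnd.
Qed.

(** [Phi] and [x - Phi x] are both cumulative, and their Stieltjes measures add up to Lebesgue
    measure on half-open intervals, hence on all measurable sets. *)
Let lsm_le A : measurable A -> (lsm cPhi A <= lebesgue_measure A)%E.
Proof.
move=> mA.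
have -> : lebesgue_measure A = (lsm cPhi A + lsm cCompl A)%E.
  rewrite (@lebesgue_measure_unique R (measure_add (lsm cPhi) (lsm cCompl))) //.
    exact: measure_addE.
  move=> X [[a b] _ <-]; rewrite [RHS]measure_addE /=.
  case: (leP a b) => ab; last by rewrite set_itv_ge ?measure0 ?adde0 // bnd_simp -leNgt ltW.
  rewrite [lsm cPhi _]lsm_oc // [lsm cCompl _]lsm_oc // -EFinD.
  by rewrite -[lebesgue_measure _]/(lsm _ _) lsm_oc //=; congr EFin; ring.
by rewrite leeDl.
Qed.

Let mI : measurable (`]0, 1]%classic : set (measurableTypeR R)). Proof. exact: measurable_itv. Qed.

Let fin : (lsm cPhi (`]0%R, 1%R]%classic : set (measurableTypeR R)) < +oo)%E.
Proof. by rewrite lsm_oc // ltry. Qed.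

(** Domination by Lebesgue measure gives absolute continuity; restricting to []0, 1]] makes the
    measure finite for Radon-Nikodym. *)
Lemma lipschitz_density : exists h : R -> R, [/\ measurable_fun setT h, forall x, 0 <= h x,
  lebesgue_measure.-integrable setT (EFin \o h) &
  forall a b, 0 <= a -> a <= b -> b <= 1 ->
    (\int[lebesgue_measure]_(x in `]a, b]) (h x)%:E)%E = (Phi b - Phi a)%:E].
Proof.
have [|f [f0 ffin fi fE]] :=
  @radon_nikodym_sigma_finite _ _ R lebesgue_measure (mfrestr mI fin).
  apply/null_content_dominatesP => A mA A0; apply/eqP; rewrite eq_le measure_ge0 andbT.
  rewrite -A0; apply: le_trans (lsm_le mA).
  rewrite /mfrestr /mrestr; apply: le_measure; rewrite ?inE //; exact: measurableI.
have fh : f = EFin \o (fine \o f) by apply/funext => x /=; rewrite fineK.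
exists (fine \o f); split.
- apply/measurable_EFinP; rewrite -fh; exact: measurable_int fi.
- by move=> x /=; rewrite fine_ge0.
- by rewrite -fh.
- move=> a b a0 ab b1.
  transitivity (lsm cPhi `]a, b]%classic); last exact: lsm_oc.
  transitivity (\int[lebesgue_measure]_(x in `]a, b]) f x)%E.
    by apply: eq_integral => x _ /=; rewrite fineK.
  rewrite -fE //; rewrite /mfrestr /mrestr; congr lsm.
  apply/setIidPl => x /=; rewrite !in_itv /= => /andP[ax xb].
  by rewrite (le_lt_trans a0 ax) (le_trans xb b1).
Qed.

End density.

Lemma locally_constant_slope (R : realType) (f : R -> R) :
  (forall a e, 0 < e -> exists2 d, 0 < d &
    forall x, `|x - a| < d -> `|f x - f a| <= e * `|x - a|) ->
  forall x y, f x = f y.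
Proof.
move=> fl x y; apply: is_derive_0_is_cst => a.
have lim0 : (fun k : R => k^-1 *: (f (k *: 1 + a) - f a)) @ 0^' --> (0 : R).
  apply/cvgrPdist_le => e e0; have [d d0 fd] := fl a e e0.
  exists d => //= k /= kd k0; rewrite sub0r normrN in kd.
  rewrite sub0r normrN normrM normfV ler_pdivrMl ?normr_gt0 // mulrC.
  have := fd (k *: 1 + a); rewrite addrK => /(_ _)/le_trans; apply.
    by rewrite /GRing.scale /= mulr1.
  by rewrite /GRing.scale /= mulr1.
by apply: DeriveDef; [apply/cvg_ex; exists 0 | exact/cvg_lim].
Qed.

(** * Averages over the agents of a grid *)

Section grid.
Variable R : realType.
Implicit Types (f : nat -> R) (x y s t : R).

Definition grid (N : nat) (j : nat) : R := j%:R / N.+1%:R.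

(** The strict inequality makes the sum empty at [s = 0] and complete at [s = 1], since the last
    grid point is [N / (N+1)]. *)
Definition gsum (N : nat) f s : R := N.+1%:R^-1 * \sum_(j < N.+1 | grid N j < s) f j.

Lemma count_interval x y n : x <= y ->
  \sum_(j < n | x <= j%:R < y) (1 : R) <= (y - x) + 1.
Proof.
(* The extra bound carries the induction: when [n] itself is counted, the earlier integers number at
   most [n - x], and [n < y]. *)
move=> xy; suff : \sum_(j < n | x <= j%:R < y) (1 : R) <= Num.max 0 (n%:R - x) /\
  \sum_(j < n | x <= j%:R < y) (1 : R) <= (y - x) + 1 by case.
elim: n => [|n [IH1 IH2]].
  by rewrite big_ord0 le_max lexx; split => //; rewrite addr_ge0 // subr_ge0.
rewrite big_mkcond big_ord_recr /= -big_mkcond /= -natr1.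
case: ifP => [/andP[xn ny]|_]; last first.
  rewrite addr0; split => //; apply: le_trans IH1 _.
  by rewrite ge_max le_max lexx /= le_max; apply/orP; right; lra.
rewrite (max_idPr _) in IH1; last by rewrite subr_ge0.
by split; [rewrite le_max; apply/orP; right|]; lra.
Qed.

Lemma gsumB N f s t : s <= t ->
  gsum N f t - gsum N f s = N.+1%:R^-1 * \sum_(j < N.+1 | s <= grid N j < t) f j.
Proof.
move=> st; rewrite /gsum -mulrBr; congr (_ * _).
rewrite [X in X - _]big_mkcond [X in _ - X]big_mkcond [RHS]big_mkcond -sumrB /=; apply: eq_bigr => j _.
case: (ltP _ t) => jt; case: (ltP _ s) => js //=; rewrite ?subr0 ?subrr //.
by have := lt_le_trans js st; rewrite ltNge jt.
Qed.

Lemma gsumB_le N f g s t : s <= t ->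
  (forall j, s <= grid N j < t -> f j <= g j) ->
  gsum N f t - gsum N f s <= gsum N g t - gsum N g s.
Proof.
move=> st fg; rewrite !gsumB // ler_wpM2l ?invr_ge0 ?ler0n //.
by apply: ler_sum => j; exact: fg.
Qed.

Lemma gsum1B_le N s t : s <= t ->
  gsum N (fun=> 1) t - gsum N (fun=> 1) s <= (t - s) + N.+1%:R^-1.
Proof.
move=> st; rewrite gsumB // ler_pdivrMl ?ltr0n //.
have N0 : 0 < N.+1%:R :> R by rewrite ltr0n.
under eq_bigl do rewrite /grid ler_pdivlMr // ltr_pdivrMr //.
apply: le_trans (count_interval _ _) _; first by rewrite ler_pM2r.
by rewrite mulrDr mulfV ?gt_eqF // lerD2r -mulrBl mulrC.
Qed.

Lemma gsum_lin N f g s (k : R) : gsum N (fun j => f j + k * g j) s = gsum N f s + k * gsum N g s.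
Proof.
by rewrite /gsum big_split /= -mulr_sumr mulrDr mulrCA.
Qed.

Lemma gsum_bound N f s M : (forall j, (j <= N)%N -> `|f j| <= M) -> `|gsum N f s| <= M.
Proof.
move=> fM; have M0 : 0 <= M by apply: le_trans (fM 0%N _); rewrite ?normr_ge0.
rewrite /gsum normrM ger0_norm ?invr_ge0 // ler_pdivrMl ?ltr0n //.
apply: le_trans (ler_norm_sum _ _ _) _.
rewrite big_mkcond /= mulr_natl -[N.+1 in leRHS]card_ord -sumr_const.
by apply: ler_sum => j _; case: ifP => // _; rewrite fM // -ltnS.
Qed.

Lemma gsum_cst0 N s : gsum N (fun=> 0) s = 0.
Proof. by rewrite /gsum big1 ?mulr0. Qed.

Lemma gsum_ge0 N f s : (forall j, 0 <= f j) -> 0 <= gsum N f s.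
Proof. by move=> f0; rewrite /gsum mulr_ge0 ?invr_ge0 // sumr_ge0. Qed.

Lemma eq_gsum N f g s : (forall j, (j <= N)%N -> f j = g j) -> gsum N f s = gsum N g s.
Proof. by move=> fg; congr (_ * _); apply: eq_bigr => j _; rewrite fg // -ltnS. Qed.

Lemma gsum_full N f : gsum N f 1 = N.+1%:R^-1 * \sum_(j < N.+1) f j.
Proof.
congr (_ * _); apply: eq_bigl => j; rewrite /grid ltr_pdivrMr ?ltr0n // mul1r.
by rewrite ltr_nat ltn_ord.
Qed.
End grid.

(** * Weak limits of grid weights, tested against varying integrands *)

Section weak_density.
Variables (R : realType) (U : set_system nat).
Context {UU : UltraFilter U}.
Hypothesis oU : \oo `<=` U.
Local Notation mu := (@lebesgue_measure R).

(** The retraction of the line onto [[0, 1]]; it lets functions of an agent be continuous on all of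
    [R]. *)
Definition clamp (x : R) : R := Num.max 0 (Num.min 1 x).

Lemma clamp_itv x : 0 <= clamp x <= 1.
Proof. by rewrite /clamp le_max lexx ge_max ler01 ge_min lexx. Qed.

Lemma clamp_id x : 0 <= x <= 1 -> clamp x = x.
Proof. by move=> /andP[x0 x1]; rewrite /clamp (min_idPr x1) (max_idPr x0). Qed.

Lemma clamp_mono x y : x <= y -> 0 <= clamp y - clamp x <= y - x.
Proof.
move=> xy; rewrite /clamp; case: (leP 1 x) => x1; case: (leP 1 y) => y1;
  rewrite ?(max_idPr ler01) ?subrr; case: (leP 0 x) => ?; case: (leP 0 y) => ?; apply/andP; split; lra.
Qed.

Lemma clamp_lip x y : `|clamp x - clamp y| <= `|x - y|.
Proof.
wlog xy : x y / x <= y => [w|].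
  by case: (leP x y) => [/w//|/ltW /w]; rewrite distrC [leRHS]distrC.
have /andP[? ?] := clamp_mono xy.
by rewrite distrC ger0_norm // distrC ger0_norm // subr_ge0.
Qed.

(* The [c N] need not be continuous: the limits in [N] and in the point are taken jointly. *)
Definition cvg_cont (c : nat -> R -> R) (c0 : R -> R) :=
  forall a, c p.1 p.2 @[p --> filter_prod U (nbhs a)] --> c0 a.

Lemma cvg_contP c c0 a e : cvg_cont c c0 -> 0 < e ->
  exists2 d, 0 < d & \forall N \near U, forall x, `|x - a| < d -> `|c N x - c0 a| <= e.
Proof.
move=> cc e0; have /cvgrPdist_le/(_ e e0) := cc a.
move=> [[A B] /= [UA [d /= d0 dB]] AB]; exists d => //.
apply: filterS UA => N AN x xa; rewrite distrC; apply: (AB (N, x)).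
by split => //; apply: dB; rewrite /= distrC.
Qed.

Lemma integrable_boundedM (c h : R -> R) (M : R) :
  measurable_fun setT c -> (forall x, `|c x| <= M) ->
  mu.-integrable setT (EFin \o h) -> mu.-integrable setT (EFin \o (fun x => c x * h x)).
Proof.
move=> mc cM hi; apply: (le_integrable measurableT _ _ (integrableZl measurableT M hi)).
  apply/measurable_EFinP; apply: measurable_funM; first exact: mc.
  by apply/measurable_EFinP; exact: measurable_int hi.
move=> x _ /=; rewrite lee_fin !normrM ler_wpM2r //.
exact: le_trans (cM x) (ler_norm M).
Qed.

Lemma density_integral_bound (h c0 : R -> R) (k e s t : R) :
  mu.-integrable setT (EFin \o h) -> (forall x, 0 <= h x) ->
  mu.-integrable setT (EFin \o (fun x => c0 x * h x)) ->
  (forall x, s < x <= t -> `|c0 x - k| <= e) ->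
  `|\int[mu]_(x in `]s, t]) (c0 x * h x) - k * \int[mu]_(x in `]s, t]) h x| <=
    e * \int[mu]_(x in `]s, t]) h x.
Proof.
move=> hi h0 chi ce; have mI : measurable (`]s, t]%classic : set (measurableTypeR R)) by exact: measurable_itv.
have hI : mu.-integrable `]s, t] (EFin \o h) by exact: (integrableS measurableT mI (@subsetT _ _) hi).
have chI : mu.-integrable `]s, t] (EFin \o (fun x => c0 x * h x)).
  exact: (integrableS measurableT mI (@subsetT _ _) chi).
have khI l : mu.-integrable `]s, t] (EFin \o (fun x => l * h x)).
  exact: (integrableZl mI l hI).
rewrite -!RintegralZl // -RintegralB //.
have bI : mu.-integrable `]s, t] (EFin \o (fun x => c0 x * h x - k * h x)).
  exact: (integrableB mI chI (khI k)).
apply: le_trans (le_normr_Rintegral mI bI) _.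
apply: le_Rintegral => //.
  exact: (integrable_norm bI).
move=> x; rewrite /= in_itv /= => xst.
by rewrite -mulrBl normrM (ger0_norm (h0 x)) ler_wpM2r // ce.
Qed.

(** The cumulative weights converge to a nondecreasing 1-Lipschitz function [Phi], which has a
    density. For a test function, the limit [L] of the weighted sums and the integral [I] have near
    [a] the same increments [c0 a * (Phi b' - Phi b)] up to an arbitrarily small slope; so [L - I]
    has derivative zero and vanishes at 0. *)
Lemma weak_density (y : nat -> nat -> R) : (forall N j, 0 <= y N j <= 1) ->
  exists h : R -> R, [/\ measurable_fun setT h, forall x, 0 <= h x,
    mu.-integrable setT (EFin \o h) &
    forall c c0 M, (forall N x, `|c N x| <= M) -> continuous c0 -> (forall x, `|c0 x| <= M) ->
      cvg_cont c c0 -> forall s, 0 <= s <= 1 ->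
      gsum N (fun j => c N (grid R N j) * y N j) s @[N --> U] -->
        \int[mu]_(x in `]0, s]) (c0 x * h x)].
Proof.
move=> y01; have yn N j : `|y N j| <= 1.
  by have /andP[? ?] := y01 N j; rewrite ger0_norm.
have /choice[Phi PhiP] s : exists l : R, gsum N (y N) s @[N --> U] --> l.
  have [l _ ?] := @ultra_cvg R U (fun N => gsum N (y N) s) (-1) 1 UU
    (fun N => eqbLR (ler_norml _ _) (gsum_bound s (fun j _ => yn N j))).
  by exists l.
have Phi_incr a b : a <= b -> 0 <= Phi b - Phi a <= b - a.
  move=> ab; have dP : gsum N (y N) b - gsum N (y N) a @[N --> U] --> Phi b - Phi a.
    by apply: cvgB.
  apply/andP; split.
    apply: (cvgr_to_ge dP); apply: filterE => N /=.
    have := @gsumB_le R N (fun=> 0) (y N) a b ab (fun j _ => proj1 (andP (y01 N j))).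
    by rewrite !gsum_cst0 subrr.
  have lim : (b - a) + N.+1%:R^-1 @[N --> U] --> (b - a) + 0.
    by apply: cvgD; [exact: cvg_cst | exact: cvg_inv_nat].
  rewrite addr0 in lim; apply: (ler_cvg_to dP lim); apply: filterE => N /=.
  apply: le_trans (gsum1B_le N ab).
  exact: (@gsumB_le R N (y N) (fun=> 1) a b ab (fun j _ => proj2 (andP (y01 N j)))).
have [h [mh h0 hi hP]] := lipschitz_density Phi_incr.
exists h; split => // c c0 M cM c0c c0M cc s s01.
have intP a b : 0 <= a -> a <= b -> b <= 1 -> \int[mu]_(x in `]a, b]) h x = Phi b - Phi a.
  by move=> a0 ab b1; rewrite /Rintegral hP.
have chi : mu.-integrable setT (EFin \o (fun x => c0 x * h x)).
  by apply: (integrable_boundedM (M := M)) => //; exact: continuous_measurable_fun.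
pose S N s := gsum N (fun j => c N (grid R N j) * y N j) s.
have /choice[L LP] t : exists l : R, S N t @[N --> U] --> l.
  have yM N j : `|c N (grid R N j) * y N j| <= M.
    rewrite normrM -[leRHS]mulr1; apply: ler_pM => //; exact: cM.
  have [l _ ?] := @ultra_cvg R U (S ^~ t) (-M) M UU
    (fun N => eqbLR (ler_norml _ _) (gsum_bound t (fun j _ => yM N j))).
  by exists l.
pose I t := \int[mu]_(x in `]0, t]) (c0 x * h x).
have IB a b : 0 <= a -> a <= b -> I b - I a = \int[mu]_(x in `]a, b]) (c0 x * h x).
  move=> a0 ab; apply: Rintegral_itvB; rewrite ?bnd_simp //.
  by apply: integrableS chi.
(* Composing with [clamp] extends [L - I] to the line, so that the endpoints of [[0, 1]] need no
   one-sided derivatives. *)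
pose E t := L (clamp t) - I (clamp t).
have step a e : clamp a = a -> 0 < e -> exists2 d, 0 < d & forall b b',
    0 <= b -> b <= b' -> b' <= 1 -> `|b - a| < d -> `|b' - a| < d ->
    `|(L b' - I b') - (L b - I b)| <= 2 * e * (b' - b).
  move=> ca e0; have [d1 d10 near1] := cvg_contP a cc e0.
  have [d2 /= d20 near2] : exists2 d, 0 < d & forall x, `|x - a| < d -> `|c0 x - c0 a| <= e.
    have /cvgrPdist_le/(_ e e0)[d /= d0 dP] := c0c a; exists d => // x xa.
    by rewrite distrC; apply: dP; rewrite /= distrC.
  exists (Num.min d1 d2); first by rewrite lt_min d10.
  move=> b b' b0 bb b1; rewrite !lt_min => /andP[b_1 b_2] /andP[b'_1 b'_2].
  have between x d : `|b - a| < d -> `|b' - a| < d -> b <= x <= b' -> `|x - a| < d.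
    by rewrite !ltr_norml => /andP[? ?] /andP[? ?] /andP[? ?]; apply/andP; split; lra.
  have dL : `|(L b' - L b) - c0 a * (Phi b' - Phi b)| <= e * (Phi b' - Phi b).
    have lim1 : `|(S N b' - S N b) - c0 a * (gsum N (y N) b' - gsum N (y N) b)| @[N --> U] -->
        `|(L b' - L b) - c0 a * (Phi b' - Phi b)|.
      apply: cvg_norm; apply: cvgB; first by apply: cvgB; exact: LP.
      by apply: cvgM; [exact: cvg_cst | apply: cvgB; exact: PhiP].
    have lim2 : e * (gsum N (y N) b' - gsum N (y N) b) @[N --> U] --> e * (Phi b' - Phi b).
      by apply: cvgM; [exact: cvg_cst | apply: cvgB; exact: PhiP].
    apply: (ler_cvg_to lim1 lim2); apply: filterS near1 => N cN.
    rewrite !gsumB // !(mulrCA _ N.+1%:R^-1) -mulrBr normrM ger0_norm ?invr_ge0 //.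
    rewrite ler_wpM2l ?invr_ge0 // !mulr_sumr -sumrB.
    apply: le_trans (ler_norm_sum _ _ _) _; apply: ler_sum => j /andP[jb jb'].
    have /andP[y0 _] := y01 N j.
    rewrite -mulrBl normrM (ger0_norm y0) ler_wpM2r //; apply: cN.
    by apply: between => //; rewrite jb ltW.
  have dI : `|(I b' - I b) - c0 a * (Phi b' - Phi b)| <= e * (Phi b' - Phi b).
    rewrite IB // -intP //; apply: density_integral_bound => // x /andP[/ltW xb xb'].
    by apply: near2; apply: between => //; rewrite xb.
  have /andP[P0 P1] := Phi_incr _ _ bb.
  have -> : (L b' - I b') - (L b - I b) = ((L b' - L b) - c0 a * (Phi b' - Phi b)) -
     ((I b' - I b) - c0 a * (Phi b' - Phi b)) by ring.
  apply: le_trans (ler_normB _ _) _; apply: le_trans (lerD dL dI) _.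
  have := ler_wpM2l (ltW e0) P1; lra.
have E_cst x x' : E x = E x'.
  apply: locally_constant_slope => a e e0.
  have cca : clamp (clamp a) = clamp a by rewrite clamp_id ?clamp_itv.
  (* Half of [e], because [step] adds the error of the sums to that of the integral. *)
  have e2 : 0 < e / 2 by rewrite divr_gt0.
  have [d d0 dP] := step (clamp a) (e / 2) cca e2.
  exists d => // z za; have cza := le_lt_trans (clamp_lip z a) za.
  have aa : `|clamp a - clamp a| < d by rewrite subrr normr0.
  have /andP[z0 z1] := clamp_itv z; have /andP[a0 a1] := clamp_itv a.
  apply: (@le_trans _ _ (e * `|clamp z - clamp a|)); last by rewrite ler_wpM2l ?(ltW e0) ?clamp_lip.
  have -> : e = 2 * (e / 2) by field.
  case: (leP (clamp z) (clamp a)) => [cle|/ltW cle].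
    by rewrite distrC [in leRHS]distrC [in leRHS]ger0_norm ?subr_ge0 // dP.
  by rewrite [in leRHS]ger0_norm ?subr_ge0 // dP.
have E0 : E 0 = 0.
  rewrite /E clamp_id ?lexx ?ler01 // /I set_itv_ge ?bnd_simp ?ltxx // Rintegral_set0 subr0.
  have S0 : (fun N => S N 0) = fun=> 0; last first.
    by apply: (cvg_unique (@Rhausdorff R) (LP 0)); rewrite S0; exact: cvg_cst.
  apply/funext => N; rewrite /S /gsum big_pred0 ?mulr0 // => j.
  by apply/negbTE; rewrite -leNgt divr_ge0.
have := E_cst s 0; rewrite E0 /E clamp_id // => /eqP; rewrite subr_eq0 => /eqP LI.
by have := LP s; rewrite LI.
Qed.
End weak_density.

(** The counting bound on [[0, s]] gives the upper estimate; the one on [[s, 1]], subtracted from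
    the total mass 1, gives the lower. *)
Lemma gsum1_cvg (R : realType) (U : set_system nat) {UF : Filter U} (s : R) : \oo `<=` U ->
  0 <= s <= 1 -> gsum N (fun=> 1) s @[N --> U] --> s.
Proof.
move=> oU /andP[s0 s1].
apply: (squeeze_cvgr (f := fun N => s - N.+1%:R^-1) (h := fun N => s + N.+1%:R^-1)).
- apply: filterE => N; have := gsum1B_le N s0; have := gsum1B_le N s1.
  have -> : gsum N (fun=> 1) (0 : R) = 0.
    by rewrite /gsum big_pred0 ?mulr0 // => j; apply/negbTE; rewrite -leNgt divr_ge0.
  have -> : gsum N (fun=> 1) (1 : R) = 1.
    by rewrite gsum_full sumr_const card_ord mulVf.
  by set e := N.+1%:R^-1; set q := gsum _ _ _; move: e q => e q ? ?; apply/andP; split; lra.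
- rewrite -[X in _ --> X]subr0; apply: cvgB; [exact: cvg_cst | exact: cvg_inv_nat].
- rewrite -[X in _ --> X]addr0; apply: cvgD; [exact: cvg_cst | exact: cvg_inv_nat].
Qed.

Lemma gsum_sum (R : realType) (I : finType) N (f : I -> nat -> R) s :
  \sum_i gsum N (f i) s = gsum N (fun j => \sum_i f i j) s.
Proof. by rewrite /gsum -mulr_sumr exchange_big. Qed.

Lemma cvg_cont_cst (R : realType) (U : set_system nat) {UF : Filter U} (c0 : R -> R) :
  continuous c0 -> cvg_cont U (fun=> c0) c0.
Proof.
move=> c0c a; have := c0c a; apply: cvg_comp; exact: cvg_snd.
Qed.

Lemma lip_continuous (R : realType) (f : R -> R) (L : R) :
  (forall x y, `|f x - f y| <= L * `|x - y|) -> continuous f.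
Proof.
move=> fL x; apply: (cvg_dist_le (e := fun y => L * `|y - x|)) => //.
have dx : y - x @[y --> x] --> x - x by apply: cvgB; [exact: cvg_id | exact: cvg_cst].
by rewrite subrr in dx; have := cvgM (cvg_cst L) (cvg_norm dx); rewrite normr0 mulr0; apply.
Qed.

(** The extension of [D] by zero has a vanishing primitive, and almost everywhere it is the
    derivative of its primitive. *)
Lemma ae_eq0_intervals (R : realType) (D : R -> R) :
  (@lebesgue_measure R).-integrable `]0%R, 1%R] (EFin \o D) ->
  (forall s, 0 <= s <= 1 -> \int[@lebesgue_measure R]_(x in `]0, s]) D x = 0) ->
  {ae @lebesgue_measure R, forall x, 0 < x <= 1 -> D x = 0}.
Proof.
move=> Di D0; pose f := D \_ `]0%R, 1%R].
have mI : measurable (`]0, 1]%classic : set (measurableTypeR R)) by exact: measurable_itv.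
have fi : (@lebesgue_measure R).-integrable setT (EFin \o f).
  by move: Di => /(integrable_mkcond _ mI); apply: eq_integrable => // x _; rewrite /f /= restrict_EFin.
have F0 x : \int[@lebesgue_measure R]_(t in `]0, x]) f t = 0.
  rewrite /f -Rintegral_mkcondr; case: (ltP x 0) => x0.
    by rewrite set_itv_ge ?bnd_simp -?leNgt ?(ltW x0) // set0I Rintegral_set0.
  case: (leP x 1) => x1.
    rewrite setIidl ?D0 ?x0 // => z; rewrite /= !in_itv /= => /andP[-> zx].
    exact: le_trans zx x1.
  rewrite setIidr ?D0 ?ler01 ?lexx // => z; rewrite /= !in_itv /= => /andP[-> z1].
  exact: le_trans z1 (ltW x1).
have locf := open_integrable_locally openT fi.
have mJ y : measurable (`]0, y]%classic : set (measurableTypeR R)) by exact: measurable_itv.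
have := @FTC1 R f (BRight 0) (fun y => integrableS measurableT (mJ y) (@subsetT _ _) fi) locf.
apply: filterS; first exact: (ae_filter_ringOfSetsType (@lebesgue_measure R)).
move=> x /= + /andP[x0 x1] => /(_ x0)[_].
under eq_fun do rewrite F0.
by rewrite derive1_cst /f patchE mem_set //= in_itv /= x0.
Qed.

Lemma integrable_fsum (R : realType) (I : Type) (s : seq I) (A : set (measurableTypeR R))
    (f : I -> R -> R) : measurable A ->
  (forall i, (@lebesgue_measure R).-integrable A (EFin \o f i)) ->
  (@lebesgue_measure R).-integrable A (EFin \o (fun x => \sum_(i <- s) f i x)).
Proof.
move=> mA fi; elim: s => [|i s IH].
  by under [X in EFin \o X]eq_fun do rewrite big_nil; exact: integrable0.
under [X in EFin \o X]eq_fun do rewrite big_cons.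
exact: (integrableD mA (fi i) IH).
Qed.

Lemma Rintegral_fsum (R : realType) (I : Type) (s : seq I) (A : set (measurableTypeR R))
    (f : I -> R -> R) : measurable A ->
  (forall i, (@lebesgue_measure R).-integrable A (EFin \o f i)) ->
  \int[@lebesgue_measure R]_(x in A) (\sum_(i <- s) f i x) =
  \sum_(i <- s) \int[@lebesgue_measure R]_(x in A) f i x.
Proof.
move=> mA fi; elim: s => [|i s IH].
  by rewrite big_nil; under eq_Rintegral do rewrite big_nil; rewrite Rintegral_cst // mul0r.
rewrite big_cons -IH -RintegralD //; last exact: integrable_fsum.
by apply: eq_Rintegral => x _; rewrite big_cons.
Qed.

(** * The control problem and its equilibria *)

Section game.
Variables (R : realType) (X U : finType) (T : nat).
Variables (P : X -> U -> (X -> R) -> X -> R) (r : X -> U -> (X -> R) -> R).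
Variables (mu0 : X -> R) (u0 : U) (LP Lr : R).
Hypothesis mu0_prob : is_prob mu0.
Hypothesis P_prob : forall x u g, nonneg_vec g -> is_prob (P x u g).
Hypothesis r_lip : lipschitz_r Lr r.
Hypothesis P_lip : lipschitz_P LP P.
Implicit Types (g : nat -> X -> R) (pi : policy R X U).

(** * Backward induction and the gap formula *)

Definition action_value g (v : X -> R) t x u : R :=
  r x u (g t) + \sum_y P x u (g t) y * v y.

(** Starting the maximum at [q u0] keeps the result among the values of [q], so that it is
    attained. *)
Definition max_action (q : U -> R) : R := \big[Num.max/q u0]_u q u.

(* [value g k t x] is the optimal reward collected from state [x] at time [t] when [k] steps remain. *)
Fixpoint value g (k t : nat) (x : X) : R :=
  if k is k'.+1 then max_action (action_value g (value g k' t.+1) t x) else 0.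

(** The loss incurred by playing [u] once and optimally afterwards. *)
Definition gap g t x u : R :=
  value g (T - t) t x - action_value g (value g (T - t.+1) t.+1) t x u.

Fixpoint law g pi (t : nat) : X -> R :=
  if t is t'.+1 then
    fun x => \sum_x' law g pi t' x' * \sum_u pi t' x' u * P x' u (g t') x
  else mu0.

Definition payoff g pi : R :=
  \sum_(t < T) \sum_x law g pi t x * \sum_u pi t x u * r x u (g t).

Lemma max_action_ge q u : q u <= max_action q.
Proof. by rewrite /max_action; apply: le_bigmax. Qed.

Lemma max_action_eq q : exists u, max_action q = q u.
Proof.
rewrite /max_action; elim/big_ind: _ => [|a b [u ->] [v ->]|u _]; [by exists u0| |by exists u].
by case: (leP (q u) (q v)) => _; [exists v|exists u].
Qed.

Lemma value_time g t x : (t < T)%N ->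
  value g (T - t) t x = max_action (action_value g (value g (T - t.+1) t.+1) t x).
Proof. by move=> tT; rewrite -[in LHS](subnSK tT). Qed.

Lemma gap_ge0 g t x u : (t < T)%N -> 0 <= gap g t x u.
Proof. by move=> tT; rewrite /gap value_time // subr_ge0 max_action_ge. Qed.

Lemma gap_eq0 g t x : (t < T)%N -> exists u, gap g t x u = 0.
Proof.
move=> tT; rewrite /gap value_time //.
by have [u ->] := max_action_eq (action_value g (value g (T - t.+1) t.+1) t x); exists u; rewrite subrr.
Qed.

(** The performance difference identity. With [D t] the expected optimal reward still to come,
    [D t - D t.+1] is the expected reward plus the expected gap at time [t]; the sum telescopes, and
    [D T = 0]. *)
Lemma payoff_gap g pi : (forall t x, (t < T)%N -> \sum_u pi t x u = 1) ->
  payoff g pi = \sum_x mu0 x * value g T 0 x -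
    \sum_(t < T) \sum_x law g pi t x * \sum_u pi t x u * gap g t x u.
Proof.
move=> pi1; pose D t := \sum_x law g pi t x * value g (T - t) t x.
have step (t : 'I_T) : D t - D t.+1 = \sum_x law g pi t x * \sum_u pi t x u * r x u (g t) +
    \sum_x law g pi t x * \sum_u pi t x u * gap g t x u.
  have -> : D t.+1 = \sum_x law g pi t x * \sum_u pi t x u *
      \sum_y P x u (g t) y * value g (T - t.+1) t.+1 y.
    rewrite /D /=; under eq_bigr do rewrite mulr_suml.
    rewrite exchange_big /=; apply: eq_bigr => x _.
    under eq_bigr do rewrite -mulrA mulr_suml.
    rewrite -mulr_sumr exchange_big /=; congr (_ * _); apply: eq_bigr => u _.
    by rewrite mulr_sumr; apply: eq_bigr => y _; rewrite mulrA.
  rewrite /D -sumrB -big_split /=; apply: eq_bigr => x _.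
  rewrite -mulrBr -mulrDr; congr (_ * _); rewrite -big_split /=.
  rewrite -[value _ _ _ _]mul1r -(pi1 t x) // mulr_suml -sumrB; apply: eq_bigr => u _.
  by rewrite /gap /action_value; ring.
have -> : \sum_x mu0 x * value g T 0 x = \sum_(t < T) (D t - D t.+1).
  rewrite -(big_mkord xpredT (fun t => D t - D t.+1)).
  under eq_bigr do rewrite -opprB.
  rewrite sumrN GRing.Theory.telescope_sumr // opprB /D subn0 subnn /=.
  by rewrite [X in _ - X]big1 ?subr0 // => x _; rewrite mulr0.
under [X in _ = X - _]eq_bigr do rewrite step.
by rewrite big_split /= addrK.
Qed.

Section law_prob.
Variables (g : nat -> X -> R) (pi : policy R X U).
Hypothesis g_ge0 : forall t, nonneg_vec (g t).
Hypothesis pi_prob : is_policy T pi.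

Lemma law_ge0 t x : (t <= T)%N -> 0 <= law g pi t x.
Proof.
elim: t x => [|t IH] x tT /=; first by case: mu0_prob.
apply: sumr_ge0 => x' _; rewrite mulr_ge0 ?IH ?(ltnW tT) //; apply: sumr_ge0 => u _.
by rewrite mulr_ge0 //; [have [] := pi_prob x' tT | have [] := P_prob x' u (g_ge0 t)].
Qed.

Lemma law_sum1 t : (t <= T)%N -> \sum_x law g pi t x = 1.
Proof.
elim: t => [|t IH] tT /=; first by case: mu0_prob.
rewrite exchange_big /= -[RHS](IH (ltnW tT)); apply: eq_bigr => x _.
rewrite -mulr_sumr exchange_big /= -[RHS]mulr1; congr (_ * _).
have [_ <-] := pi_prob x tT; apply: eq_bigr => u _; rewrite -mulr_sumr.
by have [_ ->] := P_prob x u (g_ge0 t); rewrite mulr1.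
Qed.

Lemma law_le1 t x : (t <= T)%N -> law g pi t x <= 1.
Proof.
move=> tT; rewrite -(law_sum1 tT) (bigD1 x) //= lerDl sumr_ge0 // => y _.
exact: law_ge0.
Qed.

Lemma policy_le1 t x u : (t < T)%N -> pi t x u <= 1.
Proof.
move=> tT; have [pi0 <-] := pi_prob x tT; rewrite (bigD1 u) //= lerDl sumr_ge0 //.
Qed.

Lemma payoff_le : payoff g pi <= \sum_x mu0 x * value g T 0 x.
Proof.
rewrite payoff_gap; last by move=> t x tT; have [] := pi_prob x tT.
rewrite gerBl sumr_ge0 // => t _; apply: sumr_ge0 => x _.
rewrite mulr_ge0 ?law_ge0 // ?(ltnW (ltn_ord t)) //; apply: sumr_ge0 => u _.
by rewrite mulr_ge0 ?gap_ge0 //; have [] := pi_prob x (ltn_ord t).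
Qed.

Lemma payoff_eq : (forall t x u, (t < T)%N -> pi t x u * gap g t x u = 0) ->
  payoff g pi = \sum_x mu0 x * value g T 0 x.
Proof.
move=> pg; rewrite payoff_gap; last by move=> t x tT; have [] := pi_prob x tT.
rewrite [X in _ - X]big1 ?subr0 // => t _; rewrite big1 // => x _.
by rewrite big1 ?mulr0 // => u _; rewrite pg.
Qed.

End law_prob.

(** * Continuity of values, gaps and laws in the flow *)

Section continuity.
Variables (S : Type) (F : set_system S) (FF : Filter F).
Variables (gs : S -> nat -> X -> R) (g : nat -> X -> R).
Hypothesis gs_ge0 : forall n t, nonneg_vec (gs n t).
Hypothesis g_ge0 : forall t, nonneg_vec (g t).
Hypothesis gs_cvg : forall t x, gs n t x @[n --> F] --> g t x.

Lemma l1_cvg t : l1 (fun y => gs n t y - g t y) @[n --> F] --> (0 : R).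
Proof.
rewrite /l1 [X in _ --> X](_ : 0 = \sum_(y : X) 0); last by rewrite big1.
apply: cvg_fsum => y; rewrite -(normr0 R) -(subrr (g t y)); apply: cvg_norm.
by apply: cvgB; [exact: gs_cvg | exact: cvg_cst].
Qed.

Lemma lip_cvg (f : S -> R) (l L : R) t :
  (forall n, `|f n - l| <= L * l1 (fun y => gs n t y - g t y)) -> f n @[n --> F] --> l.
Proof.
move=> fL; apply: (cvg_dist_le fL).
by rewrite -(mulr0 L); apply: cvgM; [exact: cvg_cst | exact: l1_cvg].
Qed.

(** The filter is arbitrary because four kinds occur: the filters on indices in Brouwer's theorem,
    the ultrafilter, the neighborhoods of an agent, and products of the last two. *)
Lemma P_cvg t x u y : P x u (gs n t) y @[n --> F] --> P x u (g t) y.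
Proof.
apply: (@lip_cvg _ _ LP t) => n.
have := P_lip x x u u (gs_ge0 n t) (g_ge0 t); rewrite /ddist !eqxx /= !add0r.
by apply: le_trans; rewrite /l1 (bigD1 y) //= lerDl sumr_ge0.
Qed.

Lemma r_cvg t x u : r x u (gs n t) @[n --> F] --> r x u (g t).
Proof.
apply: (@lip_cvg _ _ Lr t) => n.
by have := r_lip x x u u (gs_ge0 n t) (g_ge0 t); rewrite /ddist !eqxx /= !add0r.
Qed.

Lemma max_action_cvg (q : S -> U -> R) (q0 : U -> R) :
  (forall u, q n u @[n --> F] --> q0 u) -> max_action (q n) @[n --> F] --> max_action q0.
Proof.
move=> qc; rewrite /max_action; elim: (index_enum U) => [|u s IH].
  by rewrite big_nil; under eq_fun do rewrite big_nil; exact: qc.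
by rewrite big_cons; under eq_fun do rewrite big_cons; apply: cvg_max.
Qed.

Lemma action_value_cvg (v : S -> X -> R) (v0 : X -> R) t x u :
  (forall y, v n y @[n --> F] --> v0 y) ->
  action_value (gs n) (v n) t x u @[n --> F] --> action_value g v0 t x u.
Proof.
move=> vc; apply: cvgD; first exact: r_cvg.
by apply: cvg_fsum => y; apply: cvgM; [exact: P_cvg | exact: vc].
Qed.

Lemma value_cvg k t x : value (gs n) k t x @[n --> F] --> value g k t x.
Proof.
elim: k t x => [|k IH] t x /=; first exact: cvg_cst.
by apply: max_action_cvg => u; apply: action_value_cvg => y; exact: IH.
Qed.

Lemma gap_cvg t x u : gap (gs n) t x u @[n --> F] --> gap g t x u.
Proof.
by apply: cvgB; [exact: value_cvg | apply: action_value_cvg => y; exact: value_cvg].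
Qed.

Lemma law_cvg (pis : S -> policy R X U) pi t x :
  (forall s x u, (s < T)%N -> pis n s x u @[n --> F] --> pi s x u) -> (t <= T)%N ->
  law (gs n) (pis n) t x @[n --> F] --> law g pi t x.
Proof.
move=> pc; elim: t x => [|t IH] x tT /=; first exact: cvg_cst.
apply: cvg_fsum => x'; apply: cvgM; first exact: IH (ltnW tT).
by apply: cvg_fsum => u; apply: cvgM; [exact: pc | exact: P_cvg].
Qed.

End continuity.

(* A continuous policy that only plays actions whose gap is at most [e]. *)
Definition soft_policy (e : R) g : policy R X U := fun t x u =>
  Num.max 0 (e - gap g t x u) / \sum_v Num.max 0 (e - gap g t x v).

(** An optimal action alone contributes weight [e]. *)
Lemma soft_weight_gt0 e g t x : 0 < e -> (t < T)%N ->
  0 < \sum_v Num.max 0 (e - gap g t x v).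
Proof.
move=> e0 tT; have [u gu] := gap_eq0 g x tT.
rewrite (bigD1 u) //= gu subr0 ltr_pwDl ?lt_max ?e0 ?orbT // sumr_ge0 // => v _.
by rewrite le_max lexx.
Qed.

Lemma soft_policy_prob e g : 0 < e -> is_policy T (soft_policy e g).
Proof.
move=> e0 t x tT; have w0 := soft_weight_gt0 g x e0 tT; split=> [u|].
  by rewrite divr_ge0 ?le_max ?lexx // ltW.
by rewrite -mulr_suml divff // gt_eqF.
Qed.

Lemma soft_policy_gap e g t x u : 0 < e -> (t < T)%N ->
  0 <= soft_policy e g t x u * gap g t x u <= e.
Proof.
move=> e0 tT; have pp := soft_policy_prob g e0; have [p0 _] := pp t x tT.
rewrite mulr_ge0 ?gap_ge0 //=; have p1 := policy_le1 pp x u tT.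
case: (leP (gap g t x u) e) => [ge|eg].
  by rewrite -[leRHS]mul1r ler_pM ?gap_ge0.
rewrite /soft_policy (_ : Num.max 0 _ = 0) ?mul0r ?ltW //.
by apply/max_idPl; rewrite subr_le0 ltW.
Qed.

Lemma soft_policy_cvg (S : Type) (F : set_system S) (FF : Filter F)
    (gs : S -> nat -> X -> R) g e t x u :
  (forall n t, nonneg_vec (gs n t)) -> (forall t, nonneg_vec (g t)) ->
  (forall t x, gs n t x @[n --> F] --> g t x) -> 0 < e -> (t < T)%N ->
  soft_policy e (gs n) t x u @[n --> F] --> soft_policy e g t x u.
Proof.
move=> gs0 g0 gsg e0 tT.
have wc v : Num.max 0 (e - gap (gs n) t x v) @[n --> F] --> Num.max 0 (e - gap g t x v).
  by apply: cvg_max; [exact: cvg_cst | apply: cvgB; [exact: cvg_cst | exact: gap_cvg]].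
apply: cvgM; first exact: wc.
apply: cvgV; first by rewrite gt_eqF ?soft_weight_gt0.
by apply: cvg_fsum.
Qed.

(** * Equilibria of finite games and their limit *)

Variables (W : R -> R -> R) (LW : R).
Hypothesis W_ge0 : forall a b, a \in unit_interval -> b \in unit_interval -> 0 <= W a b.
Hypothesis LW_gt0 : 0 < LW.
Hypothesis W_lip : lipschitz_W LW W.

Definition Wc a b := W (clamp a) (clamp b).

Lemma clamp_unit a : clamp a \in @unit_interval R.
Proof. by rewrite inE /unit_interval /= in_itv /= clamp_itv. Qed.

Lemma Wc_ge0 a b : 0 <= Wc a b.
Proof. by rewrite W_ge0 ?clamp_unit. Qed.

Lemma Wc_lip a b a' b' : `|Wc a b - Wc a' b'| <= LW * (`|a - a'| + `|b - b'|).
Proof.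
apply: le_trans (W_lip _ _ _ _) _; rewrite ?clamp_unit //.
by rewrite ler_wpM2l ?(ltW LW_gt0) // lerD // clamp_lip.
Qed.

(** The Lipschitz estimate from the corner [(0, 0)], where the two distances sum to at most 2; the
    final 1 secures a positive side for the Brouwer cube. *)
Definition Wmax : R := Wc 0 0 + 2 * LW + 1.

Lemma Wmax_gt0 : 0 < Wmax.
Proof. by rewrite ltr_wpDl // addr_ge0 ?Wc_ge0 // mulr_ge0 // ltW. Qed.

Lemma Wc_le a b : Wc a b <= Wmax.
Proof.
have cc x : clamp (clamp x) = clamp x by rewrite clamp_id ?clamp_itv.
have := Wc_lip (clamp a) (clamp b) 0 0; rewrite {1}/Wc !cc -/(Wc a b) !subr0.
have /andP[a0 a1] := clamp_itv a; have /andP[b0 b1] := clamp_itv b.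
rewrite (ger0_norm a0) (ger0_norm b0) => h; have := le_trans (ler_norm _) h.
have : LW * (clamp a + clamp b) <= LW * 2 by rewrite ler_wpM2l ?(ltW LW_gt0) //; lra.
by rewrite /Wmax; lra.
Qed.

Lemma Wc_norm a b : `|Wc a b| <= Wmax.
Proof. by rewrite ger0_norm ?Wc_ge0 ?Wc_le. Qed.

(** The unknown of Brouwer's theorem is the flow of the [N+1] grid agents before time [T]; the
    averaging formula then extends the fixed point to every agent [a]. *)
Lemma discrete_equilibrium N e : 0 < e -> exists G : R -> nat -> X -> R,
  [/\ forall a t, nonneg_vec (G a t),
      forall a t x, (t < T)%N -> G a t x = gsum N (fun j => Wc a (grid R N j) *
        law (G (grid R N j)) (soft_policy e (G (grid R N j))) t x) 1 &
      forall a t x, (T <= t)%N -> G a t x = 0].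
Proof.
move=> e0; pose I : finType := ('I_N.+1 * 'I_T * X)%type.
pose gz (z : I -> R) (j : nat) (t : nat) (x : X) : R :=
  if insub t is Some t' then z (inord j, t', x) else 0.
have gz_ge0 z : cube Wmax z -> forall j t, nonneg_vec (gz z j t).
  move=> zb j t x; rewrite /gz; case: insubP => // t' _ _.
  by have /andP[] := zb (inord j, t', x).
pose m (z : I -> R) j t x := law (gz z j) (soft_policy e (gz z j)) t x.
pose G z a t x := gsum N (fun j => Wc a (grid R N j) * m z j t x) 1.
have mb z : cube Wmax z -> forall j t x, (t <= T)%N -> 0 <= m z j t x <= 1.
  move=> zb j t x tT; rewrite law_ge0 ?law_le1 //; do ?exact: gz_ge0; exact: soft_policy_prob.
have Gb z : cube Wmax z -> forall a t x, (t <= T)%N -> 0 <= G z a t x <= Wmax.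
  move=> zb a t x tT; have h0 j : 0 <= Wc a (grid R N j) * m z j t x.
    by have /andP[? _] := mb z zb j t x tT; rewrite mulr_ge0 ?Wc_ge0.
  rewrite gsum_ge0 //=; apply: le_trans (ler_norm _) _; apply: gsum_bound => j _.
  have /andP[? ?] := mb z zb j t x tT.
  by rewrite ger0_norm // -[leRHS]mulr1 ler_pM ?Wc_ge0 ?Wc_le.
have [||z zb zE] := @brouwer R I Wmax (fun z i => G z (grid R N i.1.1) i.1.2 i.2) Wmax_gt0.
- by move=> z zb [[k t] x] /=; rewrite Gb // ltnW.
- move=> V u z VF ub zb uz [[k t] x] /=; rewrite /G gsum_full.
  under eq_fun do rewrite gsum_full.
  apply: cvgM; first exact: cvg_cst.
  apply: cvg_fsum => j; apply: cvgM; first exact: cvg_cst.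
  have gzc s y : gz (u n) j s y @[n --> V] --> gz z j s y.
    by rewrite /gz; case: insubP => [s' _ _|_]; [exact: uz | exact: cvg_cst].
  apply: law_cvg; rewrite ?(ltnW (ltn_ord t)) //.
  + by move=> n s; exact: gz_ge0.
  + exact: gz_ge0.
  + by move=> s y v sT; apply: soft_policy_cvg => // [n s'|s']; exact: gz_ge0.
(* Cutting at [T] matches the default 0 of [gz], so that grid agents have equal flows as functions
   of all times. *)
pose G' a t x := if (t < T)%N then G z a t x else 0.
have gzE j : (j <= N)%N -> G' (grid R N j) = gz z j.
  move=> jN; apply/funext => t; apply/funext => x; rewrite /G' /gz.
  case: insubP => [t' tT tt'|]; last by move=> /negbTE ->.
  by rewrite tT -{2}zE /= inordK // tt'.
exists G'; split=> [a t x|a t x tT|a t x tT].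
- by rewrite /G'; case: ltnP => // tT; have /andP[] := Gb z zb a t x (ltnW tT).
- by rewrite {1}/G' tT; apply: eq_gsum => j jN; rewrite gzE.
- by rewrite /G' ltnNge tT.
Qed.

Local Notation mu := (@lebesgue_measure R).

(** Each condition is integrated over []0, s]], the form in which weak limits keep it. The factor
    [1 *] is the constant test function; [Num.min 1] bounds the gap, as [weak_density] requires,
    without changing its zeros. *)
Lemma limit_equilibrium : exists (g : R -> nat -> X -> R) (h : nat -> X -> U -> R -> R),
  [/\ forall a t, nonneg_vec (g a t),
      forall t x, continuous (fun a => g a t x) &
      forall t x u, (t < T)%N -> [/\ measurable_fun setT (h t x u), forall b, 0 <= h t x u b &
        mu.-integrable setT (EFin \o h t x u)]] /\
  [/\ forall a t x, (t < T)%N -> g a t x = \sum_u \int[mu]_(b in `]0, 1]) (Wc a b * h t x u b),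
      forall x s, (0 < T)%N -> 0 <= s <= 1 ->
        \sum_u \int[mu]_(b in `]0, s]) (1 * h 0%N x u b) = mu0 x * s,
      forall t y s, (t.+1 < T)%N -> 0 <= s <= 1 ->
        \sum_u \int[mu]_(b in `]0, s]) (1 * h t.+1 y u b) =
        \sum_x \sum_u \int[mu]_(b in `]0, s]) (P x u (g b t) y * h t x u b) &
      forall t x u s, (t < T)%N -> 0 <= s <= 1 ->
        \int[mu]_(b in `]0, s]) (Num.min 1 (gap (g b) t x u) * h t x u b) = 0].
Proof.
have [V [VV oV]] := ultra_nat; pose eps N : R := N.+1%:R^-1.
have eps0 N : 0 < eps N by rewrite invr_gt0.
have [G GP] := choice (fun N => @discrete_equilibrium N (eps N) (eps0 N)).
have G0 N a t : nonneg_vec (G N a t) by have [] := GP N.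
pose sp N j := soft_policy (eps N) (G N (grid R N j)).
pose m N j t x := law (G N (grid R N j)) (sp N j) t x.
have GE N a t x : (t < T)%N -> G N a t x = gsum N (fun j => Wc a (grid R N j) * m N j t x) 1.
  by have [_ + _] := GP N; apply.
have m01 N j t x : (t <= T)%N -> 0 <= m N j t x <= 1.
  by move=> tT; rewrite law_ge0 ?law_le1 //; exact: soft_policy_prob.
have GB N a t x : 0 <= G N a t x <= Wmax.
  rewrite G0 /=; case: (ltnP t T) => tT; last first.
    by have [_ _ ->] := GP N; rewrite // ltW // Wmax_gt0.
  rewrite GE //; apply: le_trans (ler_norm _) _; apply: gsum_bound => j _.
  have /andP[? ?] := m01 N j t x (ltnW tT).
  by rewrite normrM -[leRHS]mulr1 ler_pM ?Wc_norm // ger0_norm.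
have Glip N a b t x : `|G N a t x - G N b t x| <= LW * `|a - b|.
  case: (ltnP t T) => tT; last first.
    have [_ _ G00] := GP N; rewrite !G00 // subrr normr0 mulr_ge0 // ltW //.
  have -> : G N a t x - G N b t x =
      gsum N (fun j => (Wc a (grid R N j) - Wc b (grid R N j)) * m N j t x) 1.
    rewrite !GE // -[X in X - _]addr0 -mulN1r -addrA add0r -gsum_lin.
    by apply: eq_gsum => j _; ring.
  apply: gsum_bound => j _; have /andP[? ?] := m01 N j t x (ltnW tT).
  rewrite normrM -[leRHS]mulr1 ler_pM //; last by rewrite ger0_norm.
  by apply: le_trans (Wc_lip _ _ _ _) _; rewrite subrr normr0 addr0.
have /choice[g' gP] (p : R * nat * X) : exists l : R, 0 <= l <= Wmax /\
    G N p.1.1 p.1.2 p.2 @[N --> V] --> l.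
  have [l lb Gl] := @ultra_cvg R V (fun N => G N p.1.1 p.1.2 p.2) 0 Wmax VV
    (fun N => GB N p.1.1 p.1.2 p.2).
  by exists l.
pose g a t x := g' (a, t, x).
have Gg a t x : G N a t x @[N --> V] --> g a t x by have [] := gP (a, t, x).
have g0 a t : nonneg_vec (g a t) by move=> x; have [/andP[]] := gP (a, t, x).
have glip a b t x : `|g a t x - g b t x| <= LW * `|a - b|.
  have lim : `|G N a t x - G N b t x| @[N --> V] --> `|g a t x - g b t x|.
    by apply: cvg_norm; apply: cvgB; exact: Gg.
  by apply: (cvgr_to_le lim); apply: filterE => N; exact: Glip.
have gcont t x : continuous (fun a => g a t x) by apply: lip_continuous => *; exact: glip.
(* The Lipschitz constant [LW] is common to all [N], which upgrades pointwise convergence to joint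
   convergence. *)
have Gcont t x : cvg_cont V (fun N a => G N a t x) (fun a => g a t x).
  move=> a; apply: (cvg_dist_le (e := fun p => LW * `|p.2 - a| + `|G p.1 a t x - g a t x|)).
    move=> p; have -> : G p.1 p.2 t x - g a t x =
        (G p.1 p.2 t x - G p.1 a t x) + (G p.1 a t x - g a t x) by ring.
    by apply: le_trans (ler_normD _ _) _; rewrite lerD2r.
  have d1 : LW * `|p.2 - a| @[p --> filter_prod V (nbhs a)] --> LW * `|a - a|.
    apply: cvgM; first exact: cvg_cst.
    by apply: cvg_norm; apply: cvgB; [exact: cvg_snd | exact: cvg_cst].
  have d2 : `|G p.1 a t x - g a t x| @[p --> filter_prod V (nbhs a)] --> `|g a t x - g a t x|.
    apply: cvg_norm; apply: cvgB; last exact: cvg_cst.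
    by have := Gg a t x; apply: cvg_comp; exact: cvg_fst.
  by have := cvgD d1 d2; rewrite !subrr !normr0 mulr0 addr0; apply.
(* The probability that agent [j] is in state [x] and plays [u] at time [t]. *)
pose y t x u N j : R := if (t < T)%N then m N j t x * sp N j t x u else 0.
have y01 t x u N j : 0 <= y t x u N j <= 1.
  rewrite /y; case: ifP => [tT|_]; last by rewrite lexx ler01.
  have spp := soft_policy_prob (G N (grid R N j)) (eps0 N).
  have [sp0 _] := spp t x tT; have sp1 := policy_le1 spp x u tT.
  have /andP[? ?] := m01 N j t x (ltnW tT).
  by apply/andP; split; [apply: mulr_ge0 | apply: mulr_ile1] => //; exact: sp0.
have [h' hP] := choice (fun p : nat * X * U => weak_density oV (y01 p.1.1 p.1.2 p.2)).
pose h t x u := h' (t, x, u).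
have hlim t x u c c0 M s : (forall N b, `|c N b| <= M) -> continuous c0 ->
    (forall b, `|c0 b| <= M) -> cvg_cont V c c0 -> 0 <= s <= 1 ->
    gsum N (fun j => c N (grid R N j) * y t x u N j) s @[N --> V] -->
      \int[mu]_(b in `]0, s]) (c0 b * h t x u b).
  by move=> cM c0c c0M cc s01; have [_ _ _ /(_ c c0 M)] := hP (t, x, u); apply.
have ysum t x N j : (t < T)%N -> \sum_u y t x u N j = m N j t x.
  move=> tT; rewrite /y tT -mulr_sumr.
  by have [_ ->] := soft_policy_prob (G N (grid R N j)) (eps0 N) x tT; rewrite mulr1.
have n1 : `|1 : R| <= 1 by rewrite normr1.
have hlim1 t x s : (t < T)%N -> 0 <= s <= 1 -> gsum N (fun j => m N j t x) s @[N --> V] -->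
    \sum_u \int[mu]_(b in `]0, s]) (1 * h t x u b).
  move=> tT s01.
  have -> : (fun N => gsum N (fun j => m N j t x) s) =
      (fun N => \sum_u gsum N (fun j => 1 * y t x u N j) s).
    apply/funext => N; rewrite gsum_sum; apply: eq_gsum => j _.
    by rewrite -mulr_sumr ysum // mul1r.
  apply: cvg_fsum => u; apply: (@hlim t x u (fun _ _ => 1) (fun=> 1) 1) => //.
    by move=> b; exact: cvg_cst.
  by apply: cvg_cont_cst => b; exact: cvg_cst.
exists g, h; split; split => //.
- by move=> t x u tT; have [] := hP (t, x, u).
- move=> a t x tT; apply: (cvg_unique (@Rhausdorff R) (Gg a t x)).
  have -> : (fun N => G N a t x) =
      (fun N => \sum_u gsum N (fun j => Wc a (grid R N j) * y t x u N j) 1).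
    apply/funext => N; rewrite gsum_sum GE //; apply: eq_gsum => j _.
    by rewrite -mulr_sumr ysum.
  have Wcont : continuous (Wc a).
    apply: (@lip_continuous _ _ LW) => b b'.
    by apply: le_trans (Wc_lip _ _ _ _) _; rewrite subrr normr0 add0r.
  apply: cvg_fsum => u; apply: (@hlim t x u (fun=> Wc a) (Wc a) Wmax).
  + by move=> _ b; exact: Wc_norm.
  + exact: Wcont.
  + exact: Wc_norm.
  + exact: cvg_cont_cst.
  + by rewrite ler01 lexx.
- move=> x s T0 s01; apply: (cvg_unique (@Rhausdorff R) (hlim1 0%N x s T0 s01)).
  have -> : (fun N => gsum N (fun j => m N j 0%N x) s) =
      (fun N => mu0 x * gsum N (fun=> 1) s).
    apply/funext => N; rewrite -[RHS]add0r -(gsum_cst0 N s) -gsum_lin.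
    by apply: eq_gsum => j _; rewrite add0r mulr1.
  by apply: cvgM; [exact: cvg_cst | exact: gsum1_cvg].
- move=> t z s tT s01; have tT' := ltnW tT.
  apply: (cvg_unique (@Rhausdorff R) (hlim1 t.+1 z s tT s01)).
  have -> : (fun N => gsum N (fun j => m N j t.+1 z) s) = (fun N => \sum_x \sum_u
      gsum N (fun j => P x u (G N (grid R N j) t) z * y t x u N j) s).
    apply/funext => N; under eq_bigr do rewrite gsum_sum.
    rewrite gsum_sum; apply: eq_gsum => j _; rewrite /m /=.
    apply: eq_bigr => x _; rewrite mulr_sumr; apply: eq_bigr => u _.
    by rewrite /y tT' -/(m N j t x) mulrA mulrC.
  have P1 x u a : nonneg_vec a -> `|P x u a z| <= 1.
    move=> a0; have [P0 Ps] := P_prob x u a0; rewrite ger0_norm // -Ps (bigD1 z) //= lerDl.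
    exact: sumr_ge0.
  apply: cvg_fsum => x; apply: cvg_fsum => u.
  apply: (@hlim t x u (fun N b => P x u (G N b t) z) (fun b => P x u (g b t) z) 1) => //.
  + by move=> N b; exact: P1.
  + by move=> a; apply: P_cvg => // s' x'; exact: gcont.
  + by move=> b; exact: P1.
  + move=> a; apply: (@P_cvg _ (filter_prod V (nbhs a)) _ (fun p => G p.1 p.2)) => //.
    by move=> s' x'; exact: Gcont.
- move=> t x u s tT s01.
  have min_norm (q : R) : 0 <= q -> `|Num.min 1 q| <= 1.
    by move=> q0; rewrite ger0_norm ?ge_min ?lexx // le_min ler01.
  have gapc (S : Type) (F : set_system S) (FF : Filter F) (gs : S -> nat -> X -> R) g1 :
      (forall n t, nonneg_vec (gs n t)) -> (forall t, nonneg_vec (g1 t)) ->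
      (forall t x, gs n t x @[n --> F] --> g1 t x) ->
      Num.min 1 (gap (gs n) t x u) @[n --> F] --> Num.min 1 (gap g1 t x u).
    by move=> *; apply: cvg_min; [exact: cvg_cst | exact: gap_cvg].
  have lim := @hlim t x u (fun N b => Num.min 1 (gap (G N b) t x u))
    (fun b => Num.min 1 (gap (g b) t x u)) 1 s.
  apply: (cvg_unique (@Rhausdorff R) (lim _ _ _ _ s01)).
  + by move=> N b; rewrite min_norm ?gap_ge0.
  + by move=> a; apply: gapc => // s' x'; exact: gcont.
  + by move=> b; rewrite min_norm ?gap_ge0.
  + move=> a; apply: (@gapc _ (filter_prod V (nbhs a)) _ (fun p => G p.1 p.2)) => //.
    by move=> s' x'; exact: Gcont.
  (* The softened policy plays only gaps up to [eps N], so the average of law times truncated gap is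
     at most [eps N]. *)
  + apply: (cvg_dist_le (e := eps)); last exact: cvg_inv_nat.
    move=> N; rewrite subr0; apply: gsum_bound => j _; rewrite /y tT.
    have /andP[m0 m1] := m01 N j t x (ltnW tT).
    have /andP[sg0 sge] := soft_policy_gap (G N (grid R N j)) x u (eps0 N) tT.
    have [sp0 _] := soft_policy_prob (G N (grid R N j)) (eps0 N) x tT.
    have q0 := gap_ge0 (G N (grid R N j)) x u tT.
    set q := gap _ _ _ _ in q0 sge sg0 *; set p := soft_policy _ _ _ _ _ in sp0 sge sg0.
    have mg0 : 0 <= Num.min 1 q by rewrite le_min ler01.
    have p0 : 0 <= p by exact: sp0.
    rewrite -[sp _ _ _ _ _]/p ger0_norm; last by apply: mulr_ge0 => //; exact: mulr_ge0.
    rewrite mulrCA -[leRHS]mul1r; apply: ler_pM => //; first exact: mulr_ge0.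
    apply: le_trans sge; rewrite mulrC ler_wpM2l //.
    by rewrite ge_min lexx orbT.
Qed.

(** * From the limit laws to an equilibrium *)

Lemma state_law_law W' (m : mf_ens R X) a pi t :
  state_law P W' mu0 m a pi t = law (fun s => Gnb W' (fun b => m b s) a) pi t.
Proof. by elim: t => //= t ->. Qed.

Lemma law_congr g g' pi t : (forall s, (s < t)%N -> g s = g' s) -> law g pi t = law g' pi t.
Proof.
elim: t => //= t IH gg; rewrite IH => [|s st]; last by rewrite gg // ltnW.
by rewrite gg.
Qed.

Lemma payoff_congr g g' pi : (forall s, (s < T)%N -> g s = g' s) -> payoff g pi = payoff g' pi.
Proof.
move=> gg; apply: eq_bigr => t _; apply: eq_bigr => x _.
by rewrite (@law_congr g g') ?gg // => s st; rewrite gg // (ltn_trans st).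
Qed.

Let aeF : Filter (nbhs (almost_everywhere mu)) := ae_filter_ringOfSetsType mu.

Lemma exists_gmfe : exists (pi : policy_ens R X U) (m : mf_ens R X),
    is_policy_ens T pi /\ is_mf_ens T m /\
    (forall a t x, a \in unit_interval -> (t < T)%N -> m a t x = Psi P W mu0 pi t a x) /\
    (forall a, a \in unit_interval ->
       forall pi' : policy R X U, is_policy T pi' ->
         Jobj T P r W mu0 m a pi' <= Jobj T P r W mu0 m a (pi a)).
Proof.
have [g [h [[g0 gc hP] [hg hinit hflow hgap]]]] := limit_equilibrium.
have mI s : measurable (`]0, s]%classic : set (measurableTypeR R)) by exact: measurable_itv.
have hi t x u s : (t < T)%N -> mu.-integrable `]0, s] (EFin \o h t x u).
  by move=> /hP -/(_ x u)[_ _ i]; exact: (integrableS measurableT (mI s) (@subsetT _ _) i).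
have chi t x u s (c : R -> R) M : (t < T)%N -> continuous c -> (forall b, `|c b| <= M) ->
    mu.-integrable `]0, s] (EFin \o (fun b => c b * h t x u b)).
  move=> /hP -/(_ x u)[_ _ i] cc cM; apply: (integrableS measurableT (mI s) (@subsetT _ _)).
  by apply: (integrable_boundedM (M := M)) => //; exact: continuous_measurable_fun.
have hi1 t x u s : (t < T)%N -> mu.-integrable `]0, s] (EFin \o (fun b => 1 * h t x u b)).
  move=> tT; apply: (chi t x u s (fun=> 1) 1) => // b; last by rewrite normr1.
  exact: cvg_cst.
have h0 t x u b : (t < T)%N -> 0 <= h t x u b by move=> /hP -/(_ x u)[].
pose H t x b := \sum_u h t x u b.
have H1 t x b : \sum_u 1 * h t x u b = H t x b by apply: eq_bigr => u _; rewrite mul1r.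
have P1 x u a y : nonneg_vec a -> `|P x u a y| <= 1.
  move=> a0; have [P0 Ps] := P_prob x u a0; rewrite ger0_norm // -Ps (bigD1 y) //= lerDl.
  exact: sumr_ge0.
have Pc t x u y : continuous (fun b => P x u (g b t) y).
  by move=> a; apply: P_cvg => // s' x'; exact: gc.
have gapc t x u : continuous (fun b => gap (g b) t x u).
  by move=> a; apply: gap_cvg => // s' x'; exact: gc.
have muI s : 0 <= s -> fine (mu `]0, s]) = s.
  rewrite le_eqVlt => /predU1P[<-|s0].
    by rewrite set_itv_ge ?measure0 // bnd_simp ltxx.
  by rewrite lebesgue_measure_itv /= lte_fin s0 oppr0 adde0.
have ae_init : (0 < T)%N -> {ae mu, forall b, 0 < b <= 1 -> forall x, H 0%N x b = mu0 x}.
  move=> T0; suff init x : {ae mu, forall b, 0 < b <= 1 -> H 0%N x b = mu0 x}.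
    by apply: (@filterS _ _ aeF) (filter_forall aeF init) => b Hb b01 x; exact: Hb.
  have cI s : mu.-integrable `]0, s] (EFin \o (fun=> mu0 x)).
    have fin : (mu `]0%R, s]%classic < +oo)%E.
      by rewrite lebesgue_measure_itv /= lte_fin; case: ifP => _; rewrite ?ltry // oppr0 adde0 ltry.
    apply: (measurable_bounded_integrable (mI s) fin); first exact: measurable_cst.
    by exists `|mu0 x|; split => // M /ltW cM b _.
  have sI s : mu.-integrable `]0, s] (EFin \o (fun b => \sum_u 1 * h 0%N x u b)).
    by apply: integrable_fsum => // u; exact: hi1.
  have D0 s : 0 <= s <= 1 ->
      \int[mu]_(b in `]0, s]) ((\sum_u 1 * h 0%N x u b) - mu0 x) = 0.
    move=> s01; rewrite RintegralB // Rintegral_fsum //; last by move=> u; exact: hi1.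
    by rewrite hinit // Rintegral_cst // muI ?subrr //; case/andP: s01.
  have := ae_eq0_intervals (integrableB (mI 1) (sI 1) (cI 1)) D0.
  apply: (@filterS _ _ aeF) => b Db /Db /eqP; rewrite subr_eq0 => /eqP <-.
  by rewrite H1.
have ae_flow t : (t.+1 < T)%N -> {ae mu, forall b, 0 < b <= 1 -> forall y,
    H t.+1 y b = \sum_x \sum_u P x u (g b t) y * h t x u b}.
  move=> tT; suff flow y : {ae mu, forall b, 0 < b <= 1 ->
      H t.+1 y b = \sum_x \sum_u P x u (g b t) y * h t x u b}.
    by apply: (@filterS _ _ aeF) (filter_forall aeF flow) => b Hb b01 x; exact: Hb.
  have sI s : mu.-integrable `]0, s] (EFin \o (fun b => \sum_u 1 * h t.+1 y u b)).
    by apply: integrable_fsum => // u; exact: hi1.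
  have pI s x u : mu.-integrable `]0, s] (EFin \o (fun b => P x u (g b t) y * h t x u b)).
    by apply: (chi t x u s (fun b => P x u (g b t) y) 1) => //; [exact: ltnW | move=> b; exact: P1].
  have qI s x : mu.-integrable `]0, s] (EFin \o (fun b => \sum_u P x u (g b t) y * h t x u b)).
    by apply: integrable_fsum.
  have rI s : mu.-integrable `]0, s]
      (EFin \o (fun b => \sum_x \sum_u P x u (g b t) y * h t x u b)).
    by apply: integrable_fsum.
  have D0 s : 0 <= s <= 1 -> \int[mu]_(b in `]0, s]) ((\sum_u 1 * h t.+1 y u b) -
      \sum_x \sum_u P x u (g b t) y * h t x u b) = 0.
    move=> s01; rewrite RintegralB // Rintegral_fsum //; last by move=> u; exact: hi1.
    rewrite hflow // Rintegral_fsum //; apply/eqP; rewrite subr_eq0; apply/eqP.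
    by apply: eq_bigr => x _; rewrite Rintegral_fsum.
  have := ae_eq0_intervals (integrableB (mI 1) (sI 1) (rI 1)) D0.
  apply: (@filterS _ _ aeF) => b Db /Db /eqP; rewrite subr_eq0 => /eqP <-.
  by rewrite H1.
have ae_gap t : (t < T)%N -> {ae mu, forall b, 0 < b <= 1 -> forall x u,
    h t x u b * gap (g b) t x u = 0}.
  move=> tT; suff gap0 (p : X * U) : {ae mu, forall b, 0 < b <= 1 ->
      h t p.1 p.2 b * gap (g b) t p.1 p.2 = 0}.
    by apply: (@filterS _ _ aeF) (filter_forall aeF gap0) => b Hb b01 x u; exact: (Hb (x, u)).
  case: p => x u /=.
  have minI : mu.-integrable `]0%R, 1%R]
      (EFin \o (fun b => Num.min 1 (gap (g b) t x u) * h t x u b)).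
    apply: (chi t x u 1 (fun b => Num.min 1 (gap (g b) t x u)) 1) => //.
      by move=> b; apply: cvg_min; [exact: cvg_cst | exact: gapc].
    by move=> b; rewrite ger0_norm ?ge_min ?lexx // le_min ler01 gap_ge0.
  have := ae_eq0_intervals minI (fun s s01 => hgap t x u s tT s01).
  apply: (@filterS _ _ aeF) => b Db /Db /eqP; rewrite mulf_eq0 => /orP[|/eqP ->]; last by rewrite mul0r.
  by case: (leP 1 (gap (g b) t x u)) => _ /eqP e; [move: (oner_neq0 R); rewrite e eqxx | rewrite e mulr0].
(* A measurable test for conditioning at this agent, time and state: positive mass and complementary
   slackness. Where it fails, the policy is uniform on the actions with zero gap, so [pi_gap] holds
   for every agent and in every state. *)
pose good t x b := (0 < H t x b) && (\sum_v h t x v b * gap (g b) t x v == 0).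
pose pi b t x u : R := if good t x b then h t x u b / H t x b
  else (gap (g b) t x u == 0)%:R / \sum_v (gap (g b) t x v == 0)%:R.
have H0 t x b : (t < T)%N -> 0 <= H t x b by move=> tT; apply: sumr_ge0 => u _; exact: h0.
have greedy_gt0 t x b : (t < T)%N -> 0 < \sum_v (gap (g b) t x v == 0)%:R :> R.
  move=> tT; have [u gu] := gap_eq0 (g b) x tT.
  by rewrite (bigD1 u) //= gu eqxx ltr_pwDl ?ltr01 // sumr_ge0.
have pi_prob b : is_policy T (pi b).
  move=> t x tT; case gd : (good t x b); split=> [u|]; rewrite /pi gd.
  - by rewrite divr_ge0 ?h0 ?H0.
  - by rewrite -mulr_suml divff // gt_eqF //; case/andP: gd.
  - by rewrite divr_ge0 // ltW // greedy_gt0.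
  - by rewrite -mulr_suml divff // gt_eqF // greedy_gt0.
have pi_gap b t x u : (t < T)%N -> pi b t x u * gap (g b) t x u = 0.
  move=> tT; rewrite /pi /good; case: ifP => [/andP[Hpos /eqP/psumr_eq0P hz]|_]; last first.
    by case: eqP => [->|_]; rewrite ?mulr0 // mul0r mul0r.
  by rewrite mulrAC hz ?mul0r // => v _; rewrite mulr_ge0 ?h0 ?gap_ge0.
(* If the mass [H] vanishes, so do all its nonnegative parts [h], and the identity holds whatever
   the policy. *)
have pi_h b t x u : (t < T)%N -> (forall x u, h t x u b * gap (g b) t x u = 0) ->
    H t x b * pi b t x u = h t x u b.
  move=> tT hz; rewrite /pi /good [X in _ && X](_ : _ = true) ?andbT; last first.
    by apply/eqP; rewrite big1.
  case: ltP => [Hpos|Hle]; first by rewrite mulrC divfK // gt_eqF.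
  have /psumr_eq0P -> // : H t x b = 0 by apply/eqP; rewrite eq_le Hle H0.
    by rewrite (_ : H t x b = 0) ?mul0r //; apply/eqP; rewrite eq_le Hle H0.
  by move=> v _; exact: h0.
have mH t x : (t < T)%N -> measurable_fun setT (H t x).
  by move=> /hP hP'; apply: measurable_sum => u; have [] := hP' x u.
have mgap t x u : measurable_fun setT (fun b => gap (g b) t x u).
  exact: continuous_measurable_fun.
have mdiv (n d : R -> R) : measurable_fun setT n -> measurable_fun setT d ->
    (forall b, 0 <= d b) -> measurable_fun setT (fun b => n b / d b).
  move=> mn md d0; apply: measurable_funM => //.
  (* For nonnegative [d] the inverse is a real power, whose measurability is known. *)
  have -> : (fun b => (d b)^-1) = (fun b => d b `^ (-1)) by apply/funext => b; rewrite powR_inv1.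
  have := @measurableT_comp _ _ _ R R R (fun x : R => x `^ (-1)) setT d (@measurable_powR R (-1)) md.
  by apply.
have mind t x u : measurable_fun setT (fun b => (gap (g b) t x u == 0)%:R : R).
  under eq_fun do rewrite mulrb.
  by apply: measurable_fun_ifT => //; apply: measurable_fun_eqr.
have mpi t x u : (t < T)%N -> measurable_fun setT (fun b => pi b t x u).
  move=> tT; have [mh _ _] := hP t x u tT.
  apply: measurable_fun_ifT.
  - apply: measurable_and; first by apply: measurable_fun_ltr => //; exact: mH.
    apply: measurable_fun_eqr => //; apply: measurable_sum => v.
    by apply: measurable_funM => //; have [] := hP t x v tT.
  - by apply: mdiv => //; [exact: mH | move=> b; exact: H0].
  - by apply: mdiv => //; [exact: measurable_sum | move=> b; exact: sumr_ge0].
pose m := Psi P W mu0 pi.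
(* The integral over other agents sees the mean field only up to null sets: almost everywhere
   equality with [H] yields the flow [g a] for every agent [a], and the left endpoint is
   negligible. *)
have nbhd t a : (t < T)%N -> a \in unit_interval ->
    (forall x, measurable_fun unit_interval (fun b => m t b x)) ->
    {ae mu, forall b, 0 < b <= 1 -> forall x, m t b x = H t x b} ->
    Gnb W (m t) a = g a t.
  move=> tT a01 mm mae; apply/funext => x; rewrite hg //.
  have unitE b : b \in @unit_interval R -> clamp b = b.
    by rewrite inE /unit_interval /= in_itv /= => b01; exact: clamp_id.
  have ocE b : 0 < b <= 1 -> clamp b = b by move=> /andP[/ltW b0 b1]; rewrite clamp_id ?b0.
  have Wcc : continuous (Wc a).
    apply: (@lip_continuous _ _ LW) => b b'.
    by apply: le_trans (Wc_lip _ _ _ _) _; rewrite subrr normr0 add0r.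
  have WhI u : mu.-integrable `]0%R, 1%R] (EFin \o (fun b => Wc a b * h t x u b)).
    by apply: (chi t x u 1 (Wc a) Wmax) => // b; exact: Wc_norm.
  rewrite -Rintegral_fsum //.
  have mWm : measurable_fun (`]0%R, 1%R]%classic : set R) (fun b => W a b * m t b x).
    apply: (@eq_measurable_fun _ _ _ _ _ (fun b => Wc a b * m t b x)).
      by move=> b; rewrite inE /= in_itv /= => b01; rewrite /Wc unitE // ocE.
    apply: measurable_funM.
      by apply: measurable_funTS; exact: continuous_measurable_fun.
    apply: measurable_funS (mm x); first exact: measurable_itv.
    by move=> b; rewrite /unit_interval /= !in_itv /= => /andP[/ltW -> ->].
  rewrite /Gnb /Rintegral /unit_interval; congr fine.
  rewrite -integral_itv_obnd_cbnd; last by apply/measurable_EFinP; exact: mWm.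
  apply: ae_eq_integral => //.
  - by apply/measurable_EFinP; exact: mWm.
  - exact: measurable_int (integrable_fsum _ (mI 1) WhI).
  - apply: (@filterS _ _ aeF) mae => b mb; rewrite /= in_itv /= => b01.
    by rewrite mb // /Wc unitE // ocE // -mulr_sumr.
(* Measurability and almost everywhere equality must advance together: both are used to replace the
   neighborhood mean field by [g], after which the recursion of [Psi] becomes the limit evolution
   through [pi_h]. *)
have m_law t : (t < T)%N -> (forall x, measurable_fun unit_interval (fun b => m t b x)) /\
    {ae mu, forall b, 0 < b <= 1 -> forall x, m t b x = H t x b}.
  elim: t => [|t IH] tT.
    split; first by move=> x; exact: measurable_cst.
    by apply: (@filterS _ _ aeF) (ae_init tT) => b Hb b01 x; rewrite Hb.
  have tT' := ltnW tT; have [IHm IHae] := IH tT'.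
  have nb a (a01 : a \in unit_interval) := nbhd t a tT' a01 IHm IHae.
  have mE a y : a \in unit_interval -> m t.+1 a y =
      \sum_x m t a x * \sum_u pi a t x u * P x u (g a t) y.
    by move=> a01; rewrite -(nb a a01).
  split.
    move=> y; apply: (@eq_measurable_fun _ _ _ _ _
      (fun a => \sum_x m t a x * \sum_u pi a t x u * P x u (g a t) y)).
      by move=> a /= a01; rewrite mE.
    apply: measurable_sum => x; apply: measurable_funM => //.
    apply: measurable_sum => u; apply: measurable_funM; first by apply: measurable_funTS; exact: mpi.
    by apply: measurable_funTS; apply: continuous_measurable_fun; exact: Pc.
  apply: (@filterS3 _ _ aeF _ _ _ _ _ IHae (ae_flow t tT) (ae_gap t tT')) => b mb fb gb b01 y.
  have b01' : b \in unit_interval.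
    by rewrite inE /unit_interval /= in_itv /=; case/andP: b01 => /ltW -> ->.
  rewrite mE // fb //; apply: eq_bigr => x _; rewrite mb // mulr_sumr; apply: eq_bigr => u _.
  by rewrite mulrA (pi_h b t x u tT' (gb b01)) [RHS]mulrC.
have nb a t : a \in unit_interval -> (t < T)%N -> Gnb W (m t) a = g a t.
  by move=> a01 tT; have [? ?] := m_law t tT; exact: nbhd.
exists pi, (fun a t => m t a); split; last split; last split.
- split=> [a _|t x u tT]; first exact: pi_prob.
  by apply: measurable_funTS; exact: mpi.
- split=> [a t a01 tT|t x tT]; last by have [] := m_law t tT.
  have -> : m t a = law (g a) (pi a) t.
    elim: t tT => //= t IH tT; apply/funext => y; have tT' := ltnW tT.
    by rewrite -(nb a t a01 tT') -IH.
  split=> [x|]; [apply: law_ge0 | apply: law_sum1] => //; exact: ltnW.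
- by [].
- move=> a a01 pi' pi'P.
  (* A deviating agent faces the unchanged flow [g a], so its objective is a [payoff] and the gap
     formula applies. *)
  have JE p : Jobj T P r W mu0 (fun a t => m t a) a p = payoff (g a) p.
    rewrite -(@payoff_congr (fun s => Gnb W (m s) a)); last by move=> s sT; exact: nb.
    apply: eq_bigr => t _; apply: eq_bigr => x _.
    by rewrite state_law_law.
  rewrite !JE (@payoff_eq (g a) (pi a)) //; last by move=> t x u; exact: pi_gap.
  exact: payoff_le.
Qed.
End game.

Theorem theorem1 (R : realType) (X U : finType) (T : nat)
  (P : X -> U -> (X -> R) -> X -> R) (r : X -> U -> (X -> R) -> R)
  (mu0 : X -> R) (W : R -> R -> R) (LP Lr LW : R) :
  (0 < #|U|)%N ->
  is_prob mu0 ->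
  (forall x u g, nonneg_vec g -> is_prob (P x u g)) ->
  graphon W ->
  0 < Lr -> 0 < LP -> 0 < LW ->
  lipschitz_r Lr r -> lipschitz_P LP P -> lipschitz_W LW W ->
  exists (pi : policy_ens R X U) (mu : mf_ens R X),
    is_policy_ens T pi /\ is_mf_ens T mu /\
    (forall a t x, a \in unit_interval -> (t < T)%N -> mu a t x = Psi P W mu0 pi t a x) /\
    (forall a, a \in unit_interval ->
       forall pi' : policy R X U, is_policy T pi' ->
         Jobj T P r W mu0 mu a pi' <= Jobj T P r W mu0 mu a (pi a)).
Proof.
move=> /card_gt0P[u0 _] mu0_prob P_prob [_ [W_ge0 _]] _ _ LW_gt0 r_lip P_lip W_lip.
exact: (exists_gmfe T u0 mu0_prob P_prob r_lip P_lip W_ge0 LW_gt0 W_lip).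
Qed.
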